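(* (Linear analytic Artin approximation.) Let $\mathbb K\in\{\mathbb R,\mathbb C\}$, let $B,\bar B$ be Banach spaces over $\mathbb K$, and let $L(\varepsilon)=\sum_{i=0}^\infty\varepsilon^iL_i$ be an analytic family of bounded linear operators $L_i\in L[B,\bar B]$ defined near $\varepsilon=0$ in $\mathbb K$. Assume that the recursion described in the context stabilizes at some $k\ge0$ and that all subspaces in the direct sums $$B=N_1^c\oplus\cdots\oplus N_{k+1}^c\oplus N_{k+1},\qquad \bar B=R_1\oplus\cdots\oplus R_{k+1}\oplus R_{k+1}^c$$ are closed. Let $b(\varepsilon)=\sum_{i=0}^\infty\varepsilon^ib_i$, $b_i\in B$, be a formal power series with $L(\varepsilon)\cdot b(\varepsilon)=0$. Then for every $c\ge0$ there exists an analytic function $b^*(\varepsilon)$ near $\varepsilon=0$ with values in $B$ such that $L(\varepsilon)\cdot b^*(\varepsilon)=0$ and the power series of $b^*(\varepsilon)$ at $\varepsilon=0$ agrees with $b(\varepsilon)$ up to order $c$, i.e. in the coefficients of $\varepsilon^0,\dots,\varepsilon^c$.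
   Context: Notation. $L[B,\bar B]$ denotes bounded linear operators, $N[T]$ and $R[T]$ the kernel and range of $T$, $I_B$ the identity of $B$. Products of formal power series are Cauchy products. Recursion. Set $N_0:=B$, $R_0^c:=\bar B$, $\bar S_1:=S_1:=L_0$, $N_1:=N[S_1]$, $R_1:=R[S_1]$; let $N_1^c$ be a chosen complement of $N_1$ in $N_0$ and $R_1^c$ a chosen complement of $R_1$ in $R_0^c$. Set $M_1:=M^{(1)}:=I_B$. For $k\ge1$, given the upper triangular operator matrix $M^{(k)}$ ($k\times k$, entries linear maps $B\to B$) with last column $M_k$, define $$\bar S_{k+1}:=(L_1\ \cdots\ L_k)\cdot M_k,\qquad S_{k+1}:=P_{R_k^c}\bar S_{k+1},$$ where $P_{R_k^c}$ is the projection of $\bar B=R_1\oplus\cdots\oplus R_k\oplus R_k^c$ onto $R_k^c$ along $R_1\oplus\cdots\oplus R_k$. Put $N_{k+1}:=N[S_{k+1}|_{N_k}]$, $R_{k+1}:=R[S_{k+1}|_{N_k}]$; let $N_{k+1}^c$ be a chosen complement of $N_{k+1}$ in $N_k$ and $R_{k+1}^c$ a chosen complement of $R_{k+1}$ in $R_k^c$. This gives $B=N_1^c\oplus\cdots\oplus N_{k+1}^c\oplus N_{k+1}$ and $\bar B=R_1\oplus\cdots\oplus R_{k+1}\oplus R_{k+1}^c$. Let $\mathcal P_i$ be the projection onto $R_i$ with respect to the latter direct sum. $S_i$ restricts to a bijection $N_i^c\to R_i$, and $S_i^{-1}:R_i\to N_i^c$ denotes its inverse. Define an operator column $E_{k+1}=(E_{1,k+1},\dots,E_{k+1,k+1})^T$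 from bottom to top by $$E_{k+1,k+1}:=I_B,\qquad E_{i,k+1}:=-S_i^{-1}\mathcal P_i\sum_{\nu=i+1}^{k+1}\bar S_\nu E_{\nu,k+1},\quad i=k,\dots,1,$$ then the column $M_{k+1}:=\begin{pmatrix}I_B&0\\0&M^{(k)}\end{pmatrix}E_{k+1}$, and let $M^{(k+1)}$ be the $(k+1)\times(k+1)$ upper triangular matrix whose columns are $M_1,\dots,M_{k+1}$ (filled up with zeros below). Stabilization at $k\ge0$ means $R_{k+1}\ne\{0\}$ and $R_{k+l}=\{0\}$ for all $l\ge2$ (equivalently $N_k\supsetneq N_{k+1}=N_{k+l}$ for all $l\ge1$). *)

(* Defs.v *)
From Stdlib Require Import Reals Arith Lia.
From Coquelicot Require Import Coquelicot.

Set Implicit Arguments.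
Unset Strict Implicit.
Unset Printing Implicit Defensive.

Section Algebra.
Variables (K : AbsRing) (V : ModuleSpace K).

Definition is_subspace (U : V -> Prop) : Prop :=
  U zero /\
  (forall x y, U x -> U y -> U (plus x y)) /\
  (forall (a : K) x, U x -> U (scal a x)).

(* [U'] is an algebraic (not necessarily closed) complement of [U] in [W]. *)
Definition is_complement (W U U' : V -> Prop) : Prop :=
  is_subspace U' /\
  (forall x, U' x -> W x) /\
  (forall x, U x -> U' x -> x = zero) /\
  (forall x, W x -> exists u u', U u /\ U' u' /\ x = plus u u').

End Algebra.

Section KernelsRanges.
Variables (K : AbsRing) (B Bbar : ModuleSpace K) (T : nat -> B -> Bbar).

(* N_0 = B and N_(k+1) is the kernel of T_(k+1) restricted to N_k. *)
Fixpoint kernels (k : nat) : B -> Prop :=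
  match k with
  | O => fun _ => True
  | S j => fun x => kernels j x /\ T (S j) x = zero
  end.

(* R_k is the range of T_k restricted to N_(k-1); meaningful only for k >= 1. *)
Definition ranges (k : nat) : Bbar -> Prop :=
  fun y => exists x, kernels (Nat.pred k) x /\ T k x = y.

Definition stabilizes_at (k : nat) : Prop :=
  (exists y, ranges (k + 1) y /\ y <> zero) /\
  (forall l, (2 <= l)%nat -> forall y, ranges (k + l) y -> y = zero).

End KernelsRanges.

(* One run of the recursion for the coefficients L_0, L_1, ...: the choices of
   the complements N_k^c and R_k^c, together with the operators they determine.
   Indices start at 1; values at smaller indices,
   apart from N_0 and R_0^c, are irrelevant.
   The projections and the inverses of the S_i are total functions subject only
   to the equations that fix them where they are used.  [rec_M i j] is the entry
   in row i of the column M_j, so that M^(k) has the entries [rec_M i j] with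
   1 <= i, j <= k; likewise [rec_E i j] is E_(i,j). *)
Record recursion (K : AbsRing) (B Bbar : ModuleSpace K) (L : nat -> B -> Bbar)
    : Type := Recursion {
  rec_Nc : nat -> B -> Prop;
  rec_Rc : nat -> Bbar -> Prop;
  rec_Sbar : nat -> B -> Bbar;
  rec_S : nat -> B -> Bbar;
  rec_Sinv : nat -> Bbar -> B;
  rec_PRc : nat -> Bbar -> Bbar;
  rec_PR : nat -> nat -> Bbar -> Bbar;
  rec_E : nat -> nat -> B -> B;
  rec_M : nat -> nat -> B -> B;

  rec_Rc_0 : forall y, rec_Rc 0 y;
  rec_Nc_complement : forall k,
    is_complement (kernels rec_S k) (kernels rec_S (S k)) (rec_Nc (S k));
  rec_Rc_complement : forall k,
    is_complement (rec_Rc k) (ranges rec_S (S k)) (rec_Rc (S k));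

  (* [rec_PRc k]: projection onto R_k^c along R_1 + ... + R_k. *)
  rec_PRc_proj : forall k (r : nat -> Bbar) w,
    (1 <= k)%nat ->
    (forall j, (1 <= j <= k)%nat -> ranges rec_S j (r j)) -> rec_Rc k w ->
    rec_PRc k (plus (sum_n_m r 1 k) w) = w;
  (* [rec_PR k i]: projection onto R_i in Bbar = R_1 + ... + R_k + R_k^c. *)
  rec_PR_proj : forall k i (r : nat -> Bbar) w,
    (1 <= i <= k)%nat ->
    (forall j, (1 <= j <= k)%nat -> ranges rec_S j (r j)) -> rec_Rc k w ->
    rec_PR k i (plus (sum_n_m r 1 k) w) = r i;
  (* [rec_Sinv i] on R_i: inverse of the bijection S_i : N_i^c -> R_i. *)
  rec_Sinv_inverse : forall i y,
    (1 <= i)%nat -> ranges rec_S i y ->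
    rec_Nc i (rec_Sinv i y) /\ rec_S i (rec_Sinv i y) = y;

  rec_Sbar_1 : forall x, rec_Sbar 1 x = L 0%nat x;
  rec_S_1 : forall x, rec_S 1 x = L 0%nat x;
  rec_M_1 : forall x, rec_M 1 1 x = x;

  rec_Sbar_succ : forall k x, (1 <= k)%nat ->
    rec_Sbar (S k) x = sum_n_m (fun i => L i (rec_M i k x)) 1 k;
  rec_S_succ : forall k x, (1 <= k)%nat ->
    rec_S (S k) x = rec_PRc k (rec_Sbar (S k) x);

  rec_E_diag : forall k x, (1 <= k)%nat -> rec_E (S k) (S k) x = x;
  rec_E_above : forall k i x, (1 <= i <= k)%nat ->
    rec_E i (S k) x =
      opp (rec_Sinv i (rec_PR (S k) i
        (sum_n_m (fun nu => rec_Sbar nu (rec_E nu (S k) x)) (S i) (S k))));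

  rec_M_first : forall k x, (1 <= k)%nat ->
    rec_M 1 (S k) x = rec_E 1 (S k) x;
  rec_M_succ : forall k i x, (1 <= i <= k)%nat ->
    rec_M (S i) (S k) x =
      sum_n_m (fun j => rec_M i j (rec_E (S j) (S k) x)) 1 k;
  rec_M_lower : forall i j x, (1 <= j < i)%nat -> rec_M i j x = zero
}.

Definition rec_N (K : AbsRing) (B Bbar : ModuleSpace K) (L : nat -> B -> Bbar)
  (D : recursion L) : nat -> B -> Prop := kernels (rec_S D).

Definition rec_R (K : AbsRing) (B Bbar : ModuleSpace K) (L : nat -> B -> Bbar)
  (D : recursion L) : nat -> Bbar -> Prop := ranges (rec_S D).

Section Analytic.
Variables (K : AbsRing) (B Bbar : NormedModule K).

(* T = sum_i eps^i L_i, with convergence in the operator norm. *)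
Definition is_op_pseries (L : nat -> B -> Bbar) (eps : K) (T : B -> Bbar)
    : Prop :=
  forall e : posreal, eventually (fun n => forall x : B,
    norm (minus (sum_n (fun i => scal (pow_n eps i) (L i x)) n) (T x))
      <= e * norm x).

(* [Lf] is, near 0, the analytic family of bounded operators with
   coefficients L_i. *)
Definition analytic_family (Lf : K -> B -> Bbar) (L : nat -> B -> Bbar)
    : Prop :=
  (forall i, is_linear (L i)) /\
  locally (T := AbsRing_UniformSpace K) zero
    (fun eps => is_op_pseries L eps (Lf eps)).

(* [f] is analytic near 0 with power series sum_i eps^i a_i there. *)
Definition has_pseries_at_0 (f : K -> B) (a : nat -> B) : Prop :=
  locally (T := AbsRing_UniformSpace K) zero
    (fun eps => is_pseries a eps (f eps)).

(* The Cauchy product of sum_i eps^i L_i and sum_i eps^i b_i vanishes. *)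
Definition formal_solution (L : nat -> B -> Bbar) (b : nat -> B) : Prop :=
  forall n, sum_n (fun i => L i (b (n - i)%nat)) n = zero.

End Analytic.

(* Main.v *)
Require Import Defs.
From Stdlib Require Import ssreflect Reals Arith Lia Lra.
From Stdlib Require Import Classical ClassicalEpsilon.
From Coquelicot Require Import Coquelicot.

(** Write L b for the Cauchy product of the operator series with a power
    series b, and say that b vanishes below m if L b = O(eps^m). A value y is
    correctable at order m if it is the coefficient of eps^m in L b for some b
    with b_0 = 0 that vanishes below m; these y form a subgroup W_m, with
    W_0 = 0. Dividing b by eps, W_(m+1) is the set of all coefficients of
    eps^m in L b, for b vanishing below m.

    The recursion computes these subgroups ([stage_all]): N_m is the set of
    constant terms of the series that vanish below m, the column M_m gives a
    series of this kind with prescribed constant term in N_m, W_m is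
    R_1 + ... + R_m, and Bbar is the direct sum of W_m and R_m^c. If the
    recursion stabilizes at k, then no W_m exceeds W_(k+1)
    ([correctable_stable]). Hence a nonzero L b cannot have its leading
    coefficient in R_(k+1)^c: such a coefficient lies in W_(k+1) as well. To
    solve L a = 0 it is therefore enough to make all coefficients of L a from
    some order on lie in R_(k+1)^c, the earlier ones being zero.

    Since W_(k+1) + R_(k+1)^c is all of Bbar, every y equals, modulo
    R_(k+1)^c, the coefficient of eps^k in L b for some b that vanishes
    below k. As R_(k+1)^c is closed, the open mapping theorem lets b be chosen
    with coefficients bounded by a constant times the norm of y
    ([bounded_correction]). Truncate the formal solution after the order
    c + k, and add for n = 0, 1, ... a correction divisible by eps^(c+1+n)
    which brings the coefficient of eps^(c+1+k+n) into R_(k+1)^c. The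
    coefficients up to order c never change, and the uniform bound makes the
    result grow at most geometrically ([geometric_correction]). It is
    therefore a convergent series with L a = 0, whose sum is annihilated by
    the operators L(eps) ([analytic_solution]). *)

(** * Sums in abelian groups *)

Section GroupSums.
Context {G : AbelianGroup}.

Lemma minus_minus_self (a b : G) : minus a (minus a b) = b.
Proof.
  unfold minus at 1. rewrite opp_minus. unfold minus.
  rewrite plus_comm -plus_assoc (@plus_opp_l G). apply plus_zero_r.
Qed.

Lemma minus_eq_zero_inv (a b : G) : minus a b = zero -> a = b.
Proof.
  intros H. rewrite -(minus_minus_self a b) H. symmetry. apply minus_zero_r.
Qed.

Lemma minus_plus_l (a b : G) : minus (plus a b) a = b.
Proof.
  unfold minus. rewrite (plus_comm a b) -plus_assoc (@plus_opp_r G).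
  apply plus_zero_r.
Qed.

Lemma minus_plus_plus (a b c d : G) :
  minus (plus a b) (plus c d) = plus (minus a c) (minus b d).
Proof.
  unfold minus. rewrite (@opp_plus G) -!plus_assoc. f_equal.
  by rewrite plus_assoc (plus_comm b) -plus_assoc.
Qed.

Lemma sum_n_m_eq_zero {M : AbelianMonoid} (a : nat -> M) (n m : nat) :
  (forall i, (n <= i <= m)%nat -> a i = zero) -> sum_n_m a n m = zero.
Proof.
  intros H. rewrite (sum_n_m_ext_loc a (fun _ => zero)); [|exact H].
  apply sum_n_m_const_zero.
Qed.

Lemma sum_n_eq_zero {M : AbelianMonoid} (a : nat -> M) (n : nat) :
  (forall i, (i <= n)%nat -> a i = zero) -> sum_n a n = zero.
Proof. intros H. apply sum_n_m_eq_zero. intros i Hi. apply H. lia. Qed.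

Lemma sum_n_opp (a : nat -> G) (n : nat) :
  sum_n (fun i => opp (a i)) n = opp (sum_n a n).
Proof.
  induction n as [|n IH].
  - now rewrite !sum_O.
  - now rewrite !sum_Sn IH (@opp_plus G).
Qed.

End GroupSums.

(** * Coefficients of the product with an operator series *)

Section Products.
Context {K : AbsRing} {B Bbar : ModuleSpace K}.
Variable L : nat -> B -> Bbar.
Hypothesis L_plus : forall i x y, L i (plus x y) = plus (L i x) (L i y).

Definition coef (b : nat -> B) (n : nat) : Bbar :=
  sum_n (fun i => L i (b (n - i)%nat)) n.

Definition vanishes_below (m : nat) (b : nat -> B) : Prop :=
  forall i, (i < m)%nat -> coef b i = zero.

(** The condition [b 0 = zero] makes the two sides of the direct sum
    Bbar = W_m + R_m^c meet already at m = 0, where W_0 is trivial and R_0^c is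
    the whole space. *)
Definition correctable (m : nat) (y : Bbar) : Prop :=
  exists b, b 0%nat = zero /\ vanishes_below m b /\ coef b m = y.

Definition shift (d : nat) (b : nat -> B) (n : nat) : B :=
  if (n <? d)%nat then zero else b (n - d)%nat.

Lemma L_zero i : L i zero = zero.
Proof.
  apply (plus_reg_l (L i zero)). now rewrite -L_plus !plus_zero_r.
Qed.

Lemma L_opp i x : L i (opp x) = opp (L i x).
Proof.
  apply (plus_reg_l (L i x)). rewrite -L_plus (@plus_opp_r B) (@plus_opp_r Bbar). apply L_zero.
Qed.

Lemma coef_ext (b b' : nat -> B) n :
  (forall i, (i <= n)%nat -> b i = b' i) -> coef b n = coef b' n.
Proof.
  intros H. apply sum_n_ext_loc. intros i Hi. now (rewrite H; try lia).
Qed.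

Lemma coef_plus (a b : nat -> B) n :
  coef (fun i => plus (a i) (b i)) n = plus (coef a n) (coef b n).
Proof.
  unfold coef. rewrite -sum_n_plus. apply sum_n_ext. intros i. apply L_plus.
Qed.

Lemma coef_opp (b : nat -> B) n : coef (fun i => opp (b i)) n = opp (coef b n).
Proof.
  unfold coef. rewrite -sum_n_opp. apply sum_n_ext. intros i. apply L_opp.
Qed.

Lemma coef_minus (a b : nat -> B) n :
  coef (fun i => minus (a i) (b i)) n = minus (coef a n) (coef b n).
Proof. unfold minus. now rewrite coef_plus coef_opp. Qed.

Lemma coef_sum (u : nat -> nat -> B) k n :
  coef (fun i => sum_n (fun j => u j i) k) n = sum_n (fun j => coef (u j) n) k.
Proof.
  induction k as [|k IH].
  - rewrite sum_O. apply coef_ext. intros i _. apply sum_O.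
  - rewrite sum_Sn -IH -coef_plus. apply coef_ext. intros i _. apply sum_Sn.
Qed.

Lemma coef_zero_below (b : nat -> B) n :
  (forall i, (i <= n)%nat -> b i = zero) -> coef b n = zero.
Proof.
  intros H. unfold coef. apply sum_n_eq_zero. intros i Hi. rewrite H; try lia. apply L_zero.
Qed.

Lemma coef_shift_lt d (b : nat -> B) n : (n < d)%nat -> coef (shift d b) n = zero.
Proof.
  intros H. apply coef_zero_below. intros i Hi. unfold shift.
  destruct (Nat.ltb_spec i d); [easy | lia].
Qed.

Lemma coef_shift_ge d (b : nat -> B) n :
  (d <= n)%nat -> coef (shift d b) n = coef b (n - d).
Proof.
  intros H. unfold coef, sum_n.
  destruct (Nat.eq_dec d 0) as [->|Hd].
  - rewrite Nat.sub_0_r. apply sum_n_m_ext_loc. intros i Hi.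
    unfold shift. now rewrite Nat.sub_0_r.
  - rewrite (sum_n_m_Chasles _ 0 (n - d) n); try lia.
    rewrite (sum_n_m_eq_zero _ (S (n - d)) n). rewrite plus_zero_r.
    + apply sum_n_m_ext_loc. intros i Hi. unfold shift.
      destruct (Nat.ltb_spec (n - i) d); [lia|].
      now replace (n - i - d)%nat with (n - d - i)%nat by lia.
    + intros i Hi. unfold shift.
      destruct (Nat.ltb_spec (n - i) d); [apply L_zero | lia].
Qed.

Lemma vanishes_plus m a b : vanishes_below m a -> vanishes_below m b ->
  vanishes_below m (fun i => plus (a i) (b i)).
Proof.
  intros Ha Hb i Hi. rewrite coef_plus (Ha i Hi) (Hb i Hi). apply plus_zero_l.
Qed.

Lemma vanishes_minus m a b : vanishes_below m a -> vanishes_below m b ->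
  vanishes_below m (fun i => minus (a i) (b i)).
Proof.
  intros Ha Hb i Hi. rewrite coef_minus (Ha i Hi) (Hb i Hi). apply (@minus_zero_r Bbar).
Qed.

Lemma vanishes_below_le m n b :
  (m <= n)%nat -> vanishes_below n b -> vanishes_below m b.
Proof. intros Hm H i Hi. apply H. lia. Qed.

Lemma correctable_O y : correctable 0 y -> y = zero.
Proof.
  intros (b & Hb0 & _ & <-). unfold coef. rewrite sum_O. cbn. rewrite Hb0.
  apply L_zero.
Qed.

Lemma correctable_zero m : correctable m zero.
Proof.
  assert (H : forall n, coef (fun _ => zero) n = zero)
    by (intros n; now apply coef_zero_below).
  exists (fun _ => zero). repeat split; auto. intros i _. apply H.
Qed.

Lemma correctable_plus m y z :
  correctable m y -> correctable m z -> correctable m (plus y z).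
Proof.
  intros (a & Ha0 & Ha & <-) (b & Hb0 & Hb & <-).
  exists (fun i => plus (a i) (b i)). split; [|split].
  - rewrite Ha0 Hb0. apply plus_zero_l.
  - now apply vanishes_plus.
  - apply coef_plus.
Qed.

Lemma correctable_minus m y z :
  correctable m y -> correctable m z -> correctable m (minus y z).
Proof.
  intros (a & Ha0 & Ha & <-) (b & Hb0 & Hb & <-).
  exists (fun i => minus (a i) (b i)). split; [|split].
  - rewrite Ha0 Hb0. apply (@minus_eq_zero B).
  - now apply vanishes_minus.
  - apply coef_minus.
Qed.

(** Multiplication and division by eps exchange the series with zero
    constant term that vanish below m + 1 and all series that vanish below m. *)
Lemma correctable_succ m y :
  correctable (S m) y <-> exists b, vanishes_below m b /\ coef b m = y.
Proof.
  split.
  - intros (b & Hb0 & Hb & <-). exists (fun i => b (S i)).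
    assert (H : forall n, coef (fun i => b (S i)) n = coef b (S n)).
    { intros n. replace n with (S n - 1)%nat at 1 by lia.
      rewrite -coef_shift_ge; try lia. apply coef_ext. intros i _. unfold shift.
      destruct (Nat.ltb_spec i 1).
      - now replace i with 0%nat by lia.
      - f_equal. lia. }
    split; [|apply H]. intros i Hi. rewrite H. apply Hb. lia.
  - intros (b & Hb & <-). exists (shift 1 b). split; [reflexivity|]. split.
    + intros [|i] Hi.
      * apply coef_shift_lt. lia.
      * rewrite coef_shift_ge; try lia. apply Hb. lia.
    + rewrite coef_shift_ge; try lia. f_equal. lia.
Qed.

Lemma correctable_le m n y : (m <= n)%nat -> correctable m y -> correctable n y.
Proof.
  intros Hmn. revert y. induction Hmn as [|n Hmn IH]; intros y Hy; [easy|].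
  destruct (IH y Hy) as (b & _ & Hb & Hc). apply correctable_succ. now exists b.
Qed.

(** * What the recursion computes *)

Section Recursion.
Variable D : recursion L.
Notation N := (kernels (rec_S D)).
Notation R := (ranges (rec_S D)).
Notation Rc := (rec_Rc D).

(** The column M_m applied to x, read from bottom to top as a polynomial in
    eps. There is no column M_0, and the constant series takes its place. *)
Definition lift (m : nat) (x : B) (i : nat) : B :=
  match m with
  | O => match i with O => x | S _ => zero end
  | S _ => if (i <? m)%nat then rec_M D (m - i) m x else zero
  end.

(** The meaning of the first m steps of the recursion, in terms of the
    products L b alone. In particular the sum of the ranges becomes a subgroup,
    which is how additivity of the operators S_j is obtained: they are
    determined on N_(j-1) by additive data. *)
Record stage (m : nat) : Prop := Stage {
  stage_disjoint : forall y, correctable m y -> Rc m y -> y = zero;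
  stage_total : forall y, exists v w, correctable m v /\ Rc m w /\ y = plus v w;
  stage_sum : forall y, correctable m y <->
    exists r, (forall j, (1 <= j <= m)%nat -> R j (r j)) /\ y = sum_n_m r 1 m;
  stage_kernel : forall b, vanishes_below m b -> N m (b 0%nat);
  stage_lift : forall x, N m x -> vanishes_below m (lift m x)
}.

Lemma Rc_minus m y z : Rc m y -> Rc m z -> Rc m (minus y z).
Proof.
  assert (H : is_subspace (Rc m)).
  { destruct m as [|m].
    - repeat split; intros; apply rec_Rc_0.
    - apply (rec_Rc_complement D m). }
  destruct H as (_ & Hp & Hs). intros Hy Hz. unfold minus.
  rewrite -scal_opp_one. apply Hp; auto.
Qed.

Lemma rec_M_diag m x : (1 <= m)%nat -> rec_M D m m x = x.
Proof.
  destruct m as [|m]; [lia|]. intros _. induction m as [|m IH].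
  - apply rec_M_1.
  - rewrite rec_M_succ; try lia. rewrite sum_n_Sm; try lia.
    rewrite sum_n_m_eq_zero. rewrite plus_zero_l.
    + rewrite rec_E_diag; [apply IH|lia].
    + intros i Hi. apply rec_M_lower. lia.
Qed.

Lemma lift_constant m x : lift m x 0 = x.
Proof. destruct m as [|m]; [easy|]. apply (rec_M_diag (S m)). lia. Qed.

(** For positive m the lift has degree below m, so that L_0 does not contribute
    and the remaining terms are those that define Sbar_(m+1). *)
Lemma coef_lift m x : coef (lift m x) m = rec_Sbar D (S m) x.
Proof.
  destruct m as [|m].
  - unfold coef. rewrite sum_O. symmetry. apply rec_Sbar_1.
  - rewrite rec_Sbar_succ; try lia. unfold coef, sum_n.
    rewrite sum_Sn_m; try lia.
    assert (E : lift (S m) x (S m - 0) = zero)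
      by (unfold lift; destruct (Nat.ltb_spec (S m - 0) (S m)); [lia|easy]).
    rewrite E L_zero plus_zero_l. apply sum_n_m_ext_loc. intros i Hi.
    unfold lift. destruct (Nat.ltb_spec (S m - i) (S m)); [|lia].
    now replace (S m - (S m - i))%nat with i by lia.
Qed.

(** S_(m+1) x is the component of Sbar_(m+1) x in the direct sum of W_m and
    R_m^c, because the sum of R_1, ..., R_m along which the recursion projects is W_m. *)
Lemma rec_S_spec m x : stage m ->
  Rc m (rec_S D (S m) x) /\
  correctable m (minus (rec_Sbar D (S m) x) (rec_S D (S m) x)).
Proof.
  intros Hm. destruct m as [|m].
  - split; [apply rec_Rc_0|]. rewrite rec_Sbar_1 rec_S_1 minus_eq_zero.
    apply correctable_zero.
  - destruct (stage_total _ Hm (rec_Sbar D (S (S m)) x)) as (v & w & Hv & Hw & E).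
    assert (E' : rec_S D (S (S m)) x = w).
    { rewrite rec_S_succ; try lia. rewrite E.
      destruct (proj1 (stage_sum _ Hm v) Hv) as (r & Hr & ->).
      apply rec_PRc_proj; [lia|easy|easy]. }
    rewrite E' E. split; [easy|].
    rewrite (plus_comm v w) minus_plus_l. exact Hv.
Qed.

(** Two series with the same constant term that vanish below m have leading
    coefficients that differ by a correctable value; compare b with the lift of
    its constant term. *)
Lemma leading_coef m b : stage m -> vanishes_below m b ->
  correctable m (minus (coef b m) (rec_S D (S m) (b 0%nat))).
Proof.
  intros Hm Hb. rewrite (minus_trans (rec_Sbar D (S m) (b 0%nat))).
  apply correctable_plus; [|now apply rec_S_spec].
  exists (fun i => minus (b i) (lift m (b 0%nat) i)). split; [|split].
  - rewrite lift_constant. apply (@minus_eq_zero B).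
  - apply vanishes_minus; [easy|].
    apply (stage_lift _ Hm). now apply (stage_kernel _ Hm).
  - rewrite coef_minus. now rewrite coef_lift.
Qed.

(** R_(m+1) does not depend on the choices made for S_(m+1): it is cut out
    of W_(m+1) by the complement R_m^c. *)
Lemma range_spec m y : stage m -> R (S m) y <-> correctable (S m) y /\ Rc m y.
Proof.
  intros Hm. split.
  - intros (x & Hx & <-). cbn in Hx.
    destruct (rec_S_spec m x Hm) as [H1 H2]. split; [|easy].
    rewrite -(minus_minus_self (rec_Sbar D (S m) x) (rec_S D (S m) x)).
    apply correctable_minus.
    + apply correctable_succ. exists (lift m x). split.
      * now apply (stage_lift _ Hm).
      * apply coef_lift.
    + apply (correctable_le m); [lia|easy].
  - intros (Hy & Hc). apply correctable_succ in Hy. destruct Hy as (b & Hb & <-).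
    exists (b 0%nat). split; [now apply (stage_kernel _ Hm)|].
    symmetry. apply minus_eq_zero_inv, (stage_disjoint _ Hm).
    + now apply leading_coef.
    + apply Rc_minus; [easy|]. now apply rec_S_spec.
Qed.

Lemma stage_O : stage 0.
Proof.
  constructor.
  - intros y Hy _. now apply correctable_O.
  - intros y. exists zero, y. split; [apply correctable_zero|].
    split; [apply rec_Rc_0|]. symmetry. apply plus_zero_l.
  - intros y. split.
    + intros Hy. apply correctable_O in Hy. exists (fun _ => zero).
      split; [intros j Hj; lia|]. rewrite Hy sum_n_m_zero; [easy|lia].
    + intros (r & _ & ->). rewrite sum_n_m_zero; try lia. apply correctable_zero.
  - easy.
  - intros x _ i Hi. lia.
Qed.

(** If the coefficient of order m vanishes too, then S_(m+1) of the constant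
    term lies both in W_m and in R_m^c. *)
Lemma kernel_succ m b : stage m -> vanishes_below (S m) b -> N (S m) (b 0%nat).
Proof.
  intros Hm Hb.
  assert (Hb' : vanishes_below m b) by (apply (vanishes_below_le m (S m)); [lia|easy]).
  split; [now apply (stage_kernel _ Hm)|].
  apply (stage_disjoint _ Hm); [|now apply rec_S_spec].
  rewrite -(minus_minus_self (coef b m) (rec_S D (S m) (b 0%nat))).
  apply correctable_minus; [|now apply leading_coef].
  rewrite (Hb m); try lia. apply correctable_zero.
Qed.

(** The reason for the definition of the column E_(m+1): the partial sums
    of Sbar_nu E_nu, taken from the bottom up, lose their component in R_(i+1)
    when the summand nu = i + 1 is added, so that the whole sum vanishes. *)
Lemma tail_correctable m x : (forall j, (j <= m)%nat -> stage j) -> (1 <= m)%nat ->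
  N (S m) x -> forall i, (i <= m)%nat ->
  correctable i
    (sum_n_m (fun nu => rec_Sbar D nu (rec_E D nu (S m) x)) (S i) (S m)) /\
  N i (rec_E D (S i) (S m) x).
Proof.
  intros Hst Hm [Hx HSx] i Hi.
  set (tail := sum_n_m (fun nu => rec_Sbar D nu (rec_E D nu (S m) x))).
  assert (Hd : exists d, (i + d)%nat = m) by (exists (m - i)%nat; lia).
  destruct Hd as [d Hd]. revert i Hi Hd.
  induction d as [|d IH]; intros i Hi Hd.
  - replace i with m by lia. unfold tail.
    rewrite sum_n_n rec_E_diag; try lia. split; [|easy].
    destruct (rec_S_spec m x (Hst m (le_n m))) as [_ H].
    now rewrite HSx minus_zero_r in H.
  - destruct (IH (S i)) as [Ht _]; [lia|lia|].
    assert (Hsi : stage i) by (apply Hst; lia).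
    destruct (proj1 (stage_sum _ (Hst (S i) ltac:(lia)) _) Ht) as (r & Hr & Er).
    set (z := rec_Sinv D (S i) (r (S i))).
    (* z is the preimage in N_(i+1)^c of the component of the tail in R_(i+1). *)
    assert (Ez : rec_E D (S i) (S m) x = opp z).
    { rewrite rec_E_above; try lia. fold (tail (S (S i)) (S m)). unfold z.
      do 2 f_equal. rewrite Er.
      (* The projection used for E belongs to the decomposition of order m + 1,
         so the components beyond i + 1 are filled up with zeros. *)
      set (r' := fun j => if (j <=? S i)%nat then r j else zero).
      replace (sum_n_m r 1 (S i)) with (plus (sum_n_m r' 1 (S m)) zero).
      - transitivity (r' (S i)).
        + apply rec_PR_proj; [lia| |].
          * intros j Hj. unfold r'. destruct (Nat.leb_spec j (S i)).
            { apply Hr. lia. }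
            destruct (Nat.eq_dec j (S m)) as [->|Hjm].
            { now exists x. }
            destruct j as [|j]; [lia|]. apply range_spec; [apply Hst; lia|].
            split; [apply correctable_zero|].
            rewrite -(minus_eq_zero (rec_S D (S j) x)).
            apply Rc_minus; apply rec_S_spec; apply Hst; lia.
          * apply (rec_Rc_complement D m).
        + unfold r'. destruct (Nat.leb_spec (S i) (S i)); [easy|lia].
      - rewrite plus_zero_r (sum_n_m_Chasles _ 1 (S i)); try lia.
        rewrite (sum_n_m_eq_zero _ (S (S i)) (S m)). rewrite plus_zero_r.
        + apply sum_n_m_ext_loc. intros j Hj. unfold r'.
          destruct (Nat.leb_spec j (S i)); [easy|lia].
        + intros j Hj. unfold r'. destruct (Nat.leb_spec j (S i)); [lia|easy]. }
    destruct (@rec_Sinv_inverse _ _ _ _ D (S i) (r (S i))) as [HzN HzS];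
      [lia|apply Hr; lia|]. fold z in HzN, HzS.
    assert (Hz : N i z) by now apply (rec_Nc_complement D i).
    assert (Hz' : N i (opp z)).
    { rewrite -(lift_constant i z).
      apply (stage_kernel _ Hsi (fun n => opp (lift i z n))).
      intros n Hn. rewrite coef_opp (stage_lift _ Hsi z Hz n Hn).
      apply (@opp_zero Bbar). }
    rewrite Ez. split; [|easy]. unfold tail. rewrite sum_Sn_m; try lia.
    fold (tail (S (S i)) (S m)). rewrite Ez Er sum_n_Sm; try lia.
    rewrite (plus_comm (sum_n_m r 1 i)) plus_assoc.
    apply correctable_plus.
    + replace (plus (rec_Sbar D (S i) (opp z)) (r (S i))) with
        (minus (plus (rec_Sbar D (S i) (opp z)) (rec_Sbar D (S i) z))
           (minus (rec_Sbar D (S i) z) (rec_S D (S i) z))).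
      * apply correctable_minus; [|now apply rec_S_spec].
        exists (fun n => plus (lift i (opp z) n) (lift i z n)). split; [|split].
        -- rewrite !lift_constant. apply (@plus_opp_l B).
        -- apply vanishes_plus; now apply (stage_lift _ Hsi).
        -- now rewrite coef_plus !coef_lift.
      * rewrite HzS. unfold minus at 1. rewrite opp_minus -plus_assoc.
        f_equal. unfold minus. rewrite plus_comm -plus_assoc (@plus_opp_l Bbar). apply plus_zero_r.
    + apply (stage_sum _ Hsi). exists r. split; [|easy].
      intros j Hj. apply Hr. lia.
Qed.

(** The recursion for the columns of M says that the lift of order m + 1 is a
    combination of shifted lifts of lower order, with the entries of E_(m+1) as
    constant terms. The summand j = 0 accounts for the identity block. *)
Lemma lift_decomposition m x i : (1 <= m)%nat -> (i <= m)%nat ->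
  lift (S m) x i =
  sum_n (fun j => shift (m - j) (lift j (rec_E D (S j) (S m) x)) i) m.
Proof.
  intros Hm Hi. unfold sum_n. rewrite sum_Sn_m; try lia.
  unfold lift at 1. destruct (Nat.ltb_spec i (S m)); [|lia].
  destruct (Nat.eq_dec i m) as [->|Him].
  - replace (S m - m)%nat with 1%nat by lia. rewrite rec_M_first; try lia.
    rewrite sum_n_m_eq_zero. rewrite plus_zero_r.
    + unfold shift. destruct (Nat.ltb_spec m (m - 0)); [lia|].
      now replace (m - (m - 0))%nat with 0%nat by lia.
    + intros j Hj. unfold shift. destruct (Nat.ltb_spec m (m - j)); [easy|].
      unfold lift. destruct j as [|j]; [lia|].
      destruct (Nat.ltb_spec (m - (m - S j)) (S j)); [lia|easy].
  - replace (S m - i)%nat with (S (m - i)) by lia. rewrite rec_M_succ; try lia.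
    replace (shift (m - 0) _ i) with (zero : B).
    2: { unfold shift. now destruct (Nat.ltb_spec i (m - 0)); [|lia]. }
    rewrite plus_zero_l. apply sum_n_m_ext_loc. intros j Hj. unfold shift.
    destruct (Nat.ltb_spec i (m - j)).
    + apply rec_M_lower. lia.
    + unfold lift. destruct j as [|j]; [lia|].
      destruct (Nat.ltb_spec (i - (m - S j)) (S j)); [|lia].
      f_equal. lia.
Qed.

(** In the decomposition into shifted lifts the products vanish below m, and
    their coefficients of order m add up to the full tail sum, which lies in
    W_0 = 0. *)
Lemma lift_succ m x : (forall j, (j <= m)%nat -> stage j) -> N (S m) x ->
  vanishes_below (S m) (lift (S m) x).
Proof.
  intros Hst Hx n Hn. destruct (Nat.eq_dec m 0) as [->|Hm].
  - replace n with 0%nat by lia. unfold coef. rewrite sum_O.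
    unfold Nat.sub. rewrite lift_constant. rewrite -(rec_S_1 D). apply Hx.
  - assert (Ht := tail_correctable m x Hst ltac:(lia) Hx).
    set (e := fun j => rec_E D j (S m) x).
    rewrite (coef_ext _
      (fun i => sum_n (fun j => shift (m - j) (lift j (e (S j))) i) m)).
    2: { intros i Hi. apply lift_decomposition; lia. }
    rewrite coef_sum. destruct (Nat.eq_dec n m) as [->|Hnm].
    + destruct (Ht 0%nat) as [H0 _]; [lia|]. apply correctable_O in H0.
      rewrite -H0 -sum_n_m_S. apply sum_n_m_ext_loc. intros j Hj.
      rewrite coef_shift_ge; try lia.
      replace (m - (m - j))%nat with j by lia. apply coef_lift.
    + apply sum_n_eq_zero. intros j Hj.
      destruct (Nat.lt_ge_cases n (m - j)).
      * now apply coef_shift_lt.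
      * rewrite coef_shift_ge; try easy. apply (stage_lift _ (Hst j Hj)); [|lia].
        now apply Ht.
Qed.

Lemma stage_succ m : (forall j, (j <= m)%nat -> stage j) -> stage (S m).
Proof.
  intros Hst. assert (Hm : stage m) by now apply Hst.
  destruct (rec_Rc_complement D m) as (Hsub & Hincl & Hdisj & Htot).
  constructor.
  - intros y Hy Hc. apply Hdisj; [|easy]. apply range_spec; auto.
  - intros y. destruct (stage_total _ Hm y) as (v & w & Hv & Hw & ->).
    destruct (Htot w Hw) as (u & u' & Hu & Hu' & ->).
    exists (plus v u), u'. split; [|split; [easy|apply plus_assoc]].
    apply correctable_plus; [now apply (correctable_le m); [lia|]|].
    now apply range_spec in Hu.
  - intros y. split.
    + intros Hy. destruct (stage_total _ Hm y) as (v & w & Hv & Hw & E).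
      assert (HRw : R (S m) w).
      { apply range_spec; [easy|]. split; [|easy].
        rewrite -(minus_plus_l v w) -E. apply correctable_minus; [easy|].
        now apply (correctable_le m); [lia|]. }
      destruct (proj1 (stage_sum _ Hm v) Hv) as (r & Hr & Ev).
      exists (fun j => if (j <=? m)%nat then r j else w). split.
      * intros j Hj. destruct (Nat.leb_spec j m); [apply Hr; lia|].
        now replace j with (S m) by lia.
      * rewrite sum_n_Sm; try lia. destruct (Nat.leb_spec (S m) m); [lia|].
        rewrite E Ev. f_equal. apply sum_n_m_ext_loc. intros j Hj.
        now destruct (Nat.leb_spec j m); [|lia].
    + intros (r & Hr & ->). rewrite sum_n_Sm; try lia. apply correctable_plus.
      * apply (correctable_le m); [lia|]. apply (stage_sum _ Hm). exists r.
        split; [|easy]. intros j Hj. apply Hr. lia.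
      * apply (range_spec m); [easy|]. apply Hr. lia.
  - intros b. now apply kernel_succ.
  - intros x. now apply lift_succ.
Qed.

Lemma stage_all m : stage m.
Proof.
  induction m as [m IH] using lt_wf_ind. destruct m as [|m].
  - apply stage_O.
  - apply stage_succ. intros j Hj. apply IH. lia.
Qed.

(** W_(m+1) is W_m + R_(m+1), and R_(m+1) is trivial from the order k + 1 on;
    for smaller m the subgroups increase. *)
Lemma correctable_stable k : stabilizes_at (rec_S D) k ->
  forall m y, correctable m y -> correctable (k + 1) y.
Proof.
  intros [_ Hz] m. induction m as [|m IH]; intros y Hy.
  - now apply (correctable_le 0); [lia|].
  - destruct (Nat.le_gt_cases (S m) (k + 1)) as [Hle|Hgt].
    + now apply (correctable_le (S m)).
    + apply (stage_sum _ (stage_all (S m))) in Hy. destruct Hy as (r & Hr & ->).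
      rewrite sum_n_Sm; try lia. rewrite (Hz (S m - k)%nat ltac:(lia) (r (S m))).
      * rewrite plus_zero_r. apply IH, (stage_sum _ (stage_all m)).
        exists r. split; [|easy]. intros j Hj. apply Hr. lia.
      * replace (k + (S m - k))%nat with (S m) by lia. apply Hr. lia.
Qed.

End Recursion.
End Products.

(** * Norms and geometric convergence *)

Local Open Scope R_scope.

Section Norms.
Context {K : AbsRing} {V : NormedModule K}.

(** Convergence expressed by the norm. The balls of a [NormedModule] are only
    equivalent to norm balls, up to the factor [norm_factor]. *)
Definition tends (u : nat -> V) (l : V) : Prop :=
  forall e : R, 0 < e -> exists n0, forall n, (n0 <= n)%nat -> norm (minus (u n) l) < e.

Lemma norm_minus_comm (x y : V) : norm (minus x y) = norm (minus y x).
Proof. by rewrite -(@opp_minus V y x) norm_opp. Qed.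

Lemma norm_minus_triangle (z x y : V) :
  norm (minus x y) <= norm (minus x z) + norm (minus z y).
Proof. rewrite (@minus_trans V z x y). apply norm_triangle. Qed.

Lemma norm_minus_le (x y : V) : norm (minus x y) <= norm x + norm y.
Proof. rewrite -(norm_opp y). apply norm_triangle. Qed.

Lemma norm_le_minus (x y : V) : norm x <= norm (minus x y) + norm y.
Proof.
  rewrite -{1}(@minus_zero_r V x) -{2}(@minus_zero_r V y).
  apply norm_minus_triangle.
Qed.

Lemma tends_filterlim (u : nat -> V) (l : V) :
  tends u l <-> filterlim u eventually (locally l).
Proof.
  split.
  - intros H P [e HP]. destruct (H e (cond_pos e)) as [n0 Hn0].
    exists n0. intros n Hn. apply HP, norm_compat1. now apply Hn0.
  - intros H e He.
    assert (Hf := norm_factor_gt_0 (V := V)).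
    assert (He' : 0 < e / norm_factor (V := V)) by now apply Rdiv_lt_0_compat.
    destruct (H (ball l (mkposreal _ He'))) as [n0 Hn0].
    { now exists (mkposreal _ He'). }
    exists n0. intros n Hn.
    apply (Rlt_le_trans _ (norm_factor (V := V) * (e / norm_factor (V := V)))).
    + apply (norm_compat2 l (u n) (mkposreal _ He')). now apply Hn0.
    + right. field. lra.
Qed.

Lemma norm_limit_le (u : nat -> V) (l z : V) (c : R) (n0 : nat) :
  tends u l -> (forall n, (n0 <= n)%nat -> norm (minus (u n) z) <= c) ->
  norm (minus l z) <= c.
Proof.
  intros Hl Hc. apply le_epsilon. intros e He.
  destruct (Hl e He) as [n1 Hn1].
  assert (H1 := Hn1 (n0 + n1)%nat ltac:(lia)).
  assert (H2 := Hc (n0 + n1)%nat ltac:(lia)).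
  assert (H3 := norm_minus_triangle (u (n0 + n1)%nat) l z).
  rewrite norm_minus_comm in H1. lra.
Qed.

End Norms.

(** The part of completeness that the proof uses, with an explicit estimate
    of the remainder. *)
Definition geometrically_complete {K : AbsRing} (V : NormedModule K) : Prop :=
  forall (u : nat -> V) (c q : R), 0 <= q <= 1 / 2 ->
  (forall n, norm (minus (u (S n)) (u n)) <= c * q ^ n) ->
  exists l, tends u l /\ forall n, norm (minus l (u n)) <= 2 * c * q ^ n.

Lemma geometric_limit {K : AbsRing} (V : CompleteNormedModule K) :
  geometrically_complete V.
Proof.
  intros u c q Hq Hu.
  assert (Hc : 0 <= c).
  { specialize (Hu 0%nat). assert (H := norm_ge_0 (minus (u 1%nat) (u 0%nat))).
    simpl in Hu. lra. }
  set (v := fun n => minus (u (S n)) (u n)).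
  assert (Hs : forall n, sum_n v n = minus (u (S n)) (u 0%nat)).
  { induction n as [|n IH].
    - by rewrite sum_O.
    - rewrite sum_Sn IH plus_comm. unfold v. symmetry.
      apply (@minus_trans V (u (S n))). }
  assert (Hex : ex_series v).
  { apply (ex_series_le v (fun n => c * q ^ n)); [exact Hu|].
    exists (c * / (1 - q)).
    apply (is_series_scal_l (V := R_NormedModule) c (fun n => q ^ n)).
    apply is_series_geom. rewrite Rabs_pos_eq; lra. }
  destruct Hex as [s Hsum]. apply (proj2 (tends_filterlim _ _)) in Hsum.
  assert (Hl : tends u (plus s (u 0%nat))).
  { intros e He. destruct (Hsum e He) as [n0 Hn0]. exists (S n0).
    intros [|n] Hn; [lia|]. specialize (Hn0 n ltac:(lia)). rewrite Hs in Hn0.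
    assert (E : minus (u (S n)) (plus s (u 0%nat)) =
      minus (minus (u (S n)) (u 0%nat)) s).
    { unfold minus. rewrite (@opp_plus V) -plus_assoc. f_equal. apply plus_comm. }
    by rewrite E. }
  exists (plus s (u 0%nat)). split; [easy|]. intros n.
  apply (norm_limit_le _ _ _ _ n Hl). intros m Hm.
  replace m with (n + (m - n))%nat by lia. generalize (m - n)%nat as d.
  assert (Hqn : 0 <= q ^ n) by (apply pow_le; lra).
  assert (Hqs : forall d, norm (minus (u (n + d)%nat) (u n))
     <= 2 * c * q ^ n * (1 - (1 / 2) ^ d)).
  { induction d as [|d IH].
    - rewrite Nat.add_0_r (@minus_eq_zero V) (@norm_zero K V). simpl. lra.
    - eapply Rle_trans; [apply (norm_minus_triangle (u (n + d)%nat))|].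
      rewrite Nat.add_succ_r.
      assert (H := Hu (n + d)%nat). rewrite pow_add in H.
      assert (H' : q ^ d <= (1 / 2) ^ d) by (apply pow_incr; lra).
      assert (Hcq : 0 <= c * q ^ n) by now apply Rmult_le_pos.
      assert (H2 := Rmult_le_compat_l _ _ _ Hcq H').
      eapply Rle_trans; [apply Rplus_le_compat; [exact H|exact IH]|].
      rewrite -tech_pow_Rmult. lra. }
  intros d. eapply Rle_trans; [apply Hqs|].
  assert (0 <= (1 / 2) ^ d) by (apply pow_le; lra).
  assert (Hcq : 0 <= c * q ^ n) by now apply Rmult_le_pos. nra.
Qed.

(** In an arbitrary [AbsRing] scaling a vector to a prescribed size can be
    impossible; this is the property of the real and complex numbers that makes
    scaling arguments work. *)
Definition scalars_of_every_size (K : AbsRing) : Prop :=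
  forall r : R, 0 < r -> exists s s' : K,
    abs s <= r /\ abs s' <= / r /\ mult s' s = one.

Lemma scalars_R_or_C (K : AbsRing) :
  K = R_AbsRing \/ K = C_AbsRing -> scalars_of_every_size K.
Proof.
  intros [-> | ->] r Hr; assert (Hr' : 0 < / r) by now apply Rinv_0_lt_compat.
  - exists r, (/ r). rewrite /abs /mult /one /=.
    rewrite !Rabs_pos_eq; [|lra|lra]. repeat split; try lra.
    change (/ r * r = 1). field. lra.
  - exists (RtoC r), (RtoC (/ r)). rewrite /abs /mult /one /=.
    rewrite !Cmod_R !Rabs_pos_eq; [|lra|lra]. repeat split; try lra.
    rewrite -RtoC_mult. f_equal. field. lra.
Qed.

(** * The open mapping theorem *)

(** [P c y] stands for: y has a preimage of norm at most c. Using only such a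
    predicate avoids building the Banach space of preimages, here a space of
    pairs of a constrained sequence and an element of a subspace. The
    hypothesis [P_series] replaces its completeness. *)
Section OpenMapping.
Context {K : AbsRing} {Y : NormedModule K}.
Hypothesis Y_complete : geometrically_complete Y.
Hypothesis K_scalars : scalars_of_every_size K.
Variable P : R -> Y -> Prop.
Hypothesis P_le : forall c c' y, c <= c' -> P c y -> P c' y.
Hypothesis P_minus : forall c c' y y', P c y -> P c' y' -> P (c + c') (minus y y').
Hypothesis P_scal : forall a c y, P c y -> P (abs a * c) (scal a y).
Hypothesis P_series : forall c u y,
  (forall n, P (c * (1 / 2) ^ n) (u n)) -> is_series u y -> P (2 * c) y.
Hypothesis P_total : forall y, exists c, P c y.

(** The argument of Baire: otherwise there are nested balls, the ball n + 1
    avoiding all images of vectors of norm at most n, and their common point has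
    no preimage. *)
Lemma dense_in_some_ball : exists (c : R) (y0 : Y) (r : R), 0 < r /\
  forall y : Y, norm (minus y y0) < r -> forall e, 0 < e -> exists a, P c a /\ norm (minus a y) < e.
Proof.
  apply NNPP. intros Hno.
  assert (Hnext : forall (n : nat) (p : Y * R), exists q : Y * R, 0 < snd p ->
    0 < snd q /\ snd q <= 1 / 2 * snd p /\
    norm (minus (fst q) (fst p)) + snd q <= snd p /\
    forall a, P (INR n) a -> snd q < norm (minus a (fst q))).
  { intros n [y0 r]. apply NNPP. intros Hq. apply Hno. exists (INR n), y0, (r / 2).
    destruct (Rlt_le_dec 0 r) as [Hr|Hr].
    2: { exfalso. apply Hq. exists (y0, r). simpl. lra. }
    split; [lra|]. intros y Hy e He. apply NNPP. intros Ha. apply Hq.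
    exists (y, Rmin (e / 2) (r / 2)). intros _. simpl.
    assert (H1 := Rmin_l (e / 2) (r / 2)). assert (H2 := Rmin_r (e / 2) (r / 2)).
    split; [apply Rmin_pos; lra|]. split; [lra|]. split; [lra|].
    intros a HPa. apply Rnot_le_lt. intros Hle. apply Ha. exists a.
    split; [easy|lra]. }
  set (next := fun n p =>
    proj1_sig (constructive_indefinite_description _ (Hnext n p))).
  assert (next_spec : forall n p, 0 < snd p ->
    0 < snd (next n p) /\ snd (next n p) <= 1 / 2 * snd p /\
    norm (minus (fst (next n p)) (fst p)) + snd (next n p) <= snd p /\
    forall a, P (INR n) a -> snd (next n p) < norm (minus a (fst (next n p)))).
  { intros n p. exact (proj2_sig (constructive_indefinite_description _ (Hnext n p))). }
  (* A pair (y, r) stands for the ball around y of radius r. *)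
  set (balls := fix balls n : Y * R :=
    match n with O => (zero, 1) | S n => next n (balls n) end).
  assert (Hpos : forall n, 0 < snd (balls n) <= (1 / 2) ^ n).
  { induction n as [|n IH]; [simpl; lra|].
    destruct (next_spec n (balls n) (proj1 IH)) as (H1 & H2 & _).
    change (balls (S n)) with (next n (balls n)). simpl. lra. }
  assert (Hball : forall n d,
    norm (minus (fst (balls (n + d)%nat)) (fst (balls n))) + snd (balls (n + d)%nat)
      <= snd (balls n)).
  { intros n. induction d as [|d IH].
    - rewrite Nat.add_0_r (@minus_eq_zero Y) (@norm_zero K Y). lra.
    - rewrite Nat.add_succ_r.
      destruct (next_spec (n + d)%nat _ (proj1 (Hpos (n + d)%nat))) as (_ & _ & H3 & _).
      change (balls (S (n + d))) with (next (n + d)%nat (balls (n + d)%nat)).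
      assert (H := norm_minus_triangle (fst (balls (n + d)%nat))
        (fst (next (n + d)%nat (balls (n + d)%nat))) (fst (balls n))).
      lra. }
  destruct (Y_complete (fun n => fst (balls n)) 1 (1 / 2)) as (l & Hl & _).
  { lra. }
  { intros n. assert (H := Hball n 1%nat). rewrite Nat.add_1_r in H.
    assert (H1 := Hpos n). assert (H2 := Hpos (S n)). lra. }
  destruct (P_total l) as [c Hc].
  assert (Hn : exists n : nat, c <= INR n).
  { destruct (nfloor_ex (Rmax 0 c)) as [n Hn]; [apply Rmax_l|].
    exists (S n). rewrite S_INR. assert (H := Rmax_r 0 c). lra. }
  destruct Hn as [n Hn].
  destruct (next_spec n _ (proj1 (Hpos n))) as (_ & _ & _ & H4).
  specialize (H4 l (P_le _ _ _ Hn Hc)).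
  change (next n (balls n)) with (balls (S n)) in H4.
  apply (Rlt_not_le _ _ H4).
  apply (norm_limit_le _ _ _ _ (S n) Hl). intros m Hm.
  assert (H := Hball (S n) (m - S n)%nat).
  replace (S n + (m - S n))%nat with m in H by lia.
  assert (H1 := Hpos m). lra.
Qed.

(** Differences of points near y0 are approximated by differences of images,
    which moves the ball of density to the origin; scaling gives all y. *)
Lemma approximate_solution : exists c, 0 <= c /\ forall y : Y, exists a : Y,
  P (c * norm y) a /\ norm (minus y a) <= norm y / 2.
Proof.
  destruct dense_in_some_ball as (c & y0 & r & Hr & Hdense).
  (* 2 c bounds the preimages of differences, and y is scaled to norm at most r / 2,
     which contributes the factor 2 norm y / r. *)
  exists (4 * Rmax 0 c / r).
  assert (Hc0 := Rmax_l 0 c). assert (Hc1 := Rmax_r 0 c).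
  split; [apply Rdiv_le_0_compat; lra|].
  intros y. destruct (Req_dec (norm y) 0) as [Hy|Hy].
  - exists zero. rewrite Hy Rmult_0_r. apply norm_eq_zero in Hy. split.
    + destruct (P_total y) as [c' Hc']. apply (P_scal zero) in Hc'.
      by rewrite abs_zero Rmult_0_l scal_zero_l in Hc'.
    + rewrite Hy (@minus_eq_zero Y) (@norm_zero K Y). lra.
  - assert (Hy' : 0 < norm y) by (assert (H := norm_ge_0 y); lra).
    set (t := r / (2 * norm y)).
    assert (Ht : 0 < t) by (apply Rdiv_lt_0_compat; lra).
    destruct (K_scalars t Ht) as (s & s' & Hs & Hs' & Hss).
    destruct (Hdense (plus y0 (scal s y))) with (e := r / 8) as (a1 & Ha1 & Hd1).
    { replace (minus (plus y0 (scal s y)) y0) with (scal s y).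
      - eapply Rle_lt_trans; [apply norm_scal|].
        apply Rle_lt_trans with (t * norm y).
        + apply Rmult_le_compat_r; lra.
        + unfold t. replace (r / (2 * norm y) * norm y) with (r / 2) by (field; lra). lra.
      - unfold minus. rewrite (plus_comm y0) -plus_assoc (@plus_opp_r Y).
        by rewrite plus_zero_r. }
    { lra. }
    destruct (Hdense y0) with (e := r / 8) as (a0 & Ha0 & Hd0).
    { rewrite (@minus_eq_zero Y) (@norm_zero K Y). lra. }
    { lra. }
    exists (scal s' (minus a1 a0)). split.
    + apply (P_le (abs s' * (c + c))); [|now apply P_scal, P_minus].
      assert (Hs0 := abs_ge_0 s').
      apply Rle_trans with (/ t * (Rmax 0 c + Rmax 0 c)).
      * apply Rle_trans with (abs s' * (Rmax 0 c + Rmax 0 c)).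
        -- apply Rmult_le_compat_l; lra.
        -- apply Rmult_le_compat_r; lra.
      * right. unfold t. field. lra.
    + assert (Ey : minus y (scal s' (minus a1 a0)) =
        scal s' (minus (minus (plus y0 (scal s y)) a1) (minus y0 a0))).
      { transitivity (scal s' (minus (scal s y) (minus a1 a0))).
        - by rewrite (@scal_minus_distr_l _ Y s' (scal s y)) scal_assoc Hss scal_one.
        - f_equal. unfold minus. rewrite !(@opp_plus Y) !(@opp_opp Y).
          rewrite (plus_comm y0 (scal s y)) -!plus_assoc. f_equal.
          rewrite (plus_comm y0) -!plus_assoc. f_equal.
          by rewrite (plus_comm a0) plus_assoc (@plus_opp_l Y) plus_zero_l. }
      rewrite Ey. eapply Rle_trans; [apply norm_scal|].
      assert (H := norm_minus_le (minus (plus y0 (scal s y)) a1) (minus y0 a0)).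
      rewrite (norm_minus_comm _ a1) (norm_minus_comm _ a0) in H.
      apply Rle_trans with (/ t * (r / 8 + r / 8)).
      * apply Rmult_le_compat; [apply abs_ge_0|apply norm_ge_0|easy|lra].
      * unfold t. right. field. lra.
Qed.

(** Solve approximately for y, then for the remaining error, and so on: the
    errors halve at every step, so the preimages form a convergent series. *)
Lemma open_mapping : exists c, 0 <= c /\ forall y : Y, P (c * norm y) y.
Proof.
  destruct approximate_solution as (c & Hc & Happ).
  exists (2 * c). split; [lra|]. intros y.
  destruct (choice _ Happ) as [approx approx_spec].
  (* The error left after n approximate solutions. *)
  set (rest := fix rest n : Y :=
    match n with O => y | S n => minus (rest n) (approx (rest n)) end).
  assert (Hrest : forall n, norm (rest n) <= norm y * (1 / 2) ^ n).
  { induction n as [|n IH]; [simpl; lra|].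
    assert (H := proj2 (approx_spec (rest n))). simpl. lra. }
  rewrite Rmult_assoc.
  apply (P_series (c * norm y) (fun n => approx (rest n))).
  - intros n. apply (P_le (c * norm (rest n))); [|apply approx_spec].
    rewrite Rmult_assoc. now apply Rmult_le_compat_l.
  - apply tends_filterlim.
    assert (Hsum : forall n, minus (sum_n (fun n => approx (rest n)) n) y
      = opp (rest (S n))).
    { induction n as [|n IH].
      - rewrite sum_O. by rewrite -(@opp_minus Y).
      - rewrite sum_Sn. change (rest (S (S n))) with
          (minus (rest (S n)) (approx (rest (S n)))).
        rewrite (@opp_minus Y). unfold minus at 2. rewrite -IH. unfold minus.
        rewrite (plus_comm _ (approx (rest (S n)))). by rewrite -plus_assoc. }
    intros e He.
    destruct (pow_lt_1_zero (1 / 2)) with (y := e / (norm y + 1)) as [n0 Hn0].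
    { rewrite Rabs_pos_eq; lra. }
    { apply Rdiv_lt_0_compat; [lra|]. assert (H := norm_ge_0 y). lra. }
    exists n0. intros n Hn. rewrite Hsum norm_opp.
    eapply Rle_lt_trans; [apply Hrest|].
    assert (Hp := Hn0 (S n) ltac:(lia)).
    assert (Hp0 : 0 < (1 / 2) ^ S n) by (apply pow_lt; lra).
    rewrite Rabs_pos_eq in Hp; [|lra].
    assert (Hy := norm_ge_0 y).
    apply (Rmult_lt_compat_l (norm y + 1)) in Hp; [|lra].
    replace ((norm y + 1) * (e / (norm y + 1))) with e in Hp by (field; lra).
    lra.
Qed.

End OpenMapping.

(** * Series and bounded operator coefficients *)

Lemma finite_bound (f : nat -> R) (n : nat) :
  exists M, 0 <= M /\ forall i, (i <= n)%nat -> f i <= M.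
Proof.
  induction n as [|n (M & HM & Hf)].
  - exists (Rmax 0 (f 0%nat)). split; [apply Rmax_l|]. intros i Hi.
    replace i with 0%nat by lia. apply Rmax_r.
  - exists (Rmax M (f (S n))). split; [apply Rle_trans with M; [easy|apply Rmax_l]|].
    intros i Hi. destruct (Nat.eq_dec i (S n)) as [->|Hin]; [apply Rmax_r|].
    apply Rle_trans with M; [apply Hf; lia|apply Rmax_l].
Qed.

(** The factors cancel from the inside, since powers of s and s' need not
    commute with each other. *)
Lemma pow_n_cancel {K : Ring} (s s' : K) (n : nat) :
  mult s' s = one -> mult (pow_n s' n) (pow_n s n) = one.
Proof.
  intros H. induction n as [|n IH]; [apply mult_one_l|].
  change (pow_n s' (S n)) with (mult s' (pow_n s' n)).
  change (pow_n s (S n)) with (mult s (pow_n s n)).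
  rewrite -pow_n_comm_1 -mult_assoc (mult_assoc s') H mult_one_l. exact IH.
Qed.

Lemma succ_le_pow2 (n : nat) : INR (S n) <= 2 ^ n.
Proof.
  induction n as [|n IH]; [simpl; lra|].
  assert (H : 1 <= 2 ^ n) by (apply pow_R1_Rle; lra).
  rewrite S_INR -tech_pow_Rmult. lra.
Qed.

Section Series.
Context {K : AbsRing} {V : NormedModule K}.

Lemma geometric_series (u : nat -> V) (c q : R) :
  geometrically_complete V -> 0 <= q <= 1 / 2 ->
  (forall n, norm (u n) <= c * q ^ n) ->
  exists l : V, is_series u l /\ norm l <= 2 * c /\
    forall n, norm (minus l (sum_n u n)) <= 2 * c * q ^ n.
Proof.
  intros HV Hq Hu.
  assert (Hc : 0 <= c).
  { specialize (Hu 0%nat). assert (H := norm_ge_0 (u 0%nat)). simpl in Hu. lra. }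
  destruct (HV (sum_n u) (c * q) q Hq) as (l & Hl & Hlu).
  { intros n. rewrite sum_Sn.
    rewrite (minus_plus_l (G := V) (sum_n u n) (u (S n))).
    eapply Rle_trans; [apply Hu|]. simpl. lra. }
  exists l. split; [now apply tends_filterlim|]. split.
  - assert (H := norm_le_minus l (sum_n u 0)). assert (H0 := Hlu 0%nat).
    assert (H1 := Hu 0%nat). rewrite sum_O in H H0. simpl in H0, H1. nra.
  - intros n. eapply Rle_trans; [apply Hlu|].
    assert (Hqn : 0 <= q ^ n) by (apply pow_le; lra).
    assert (Hcq : 0 <= c * q ^ n) by now apply Rmult_le_pos. nra.
Qed.

Lemma is_series_sum_n (u : nat -> nat -> V) (U : nat -> V) (m : nat) :
  (forall i, is_series (fun n => u n i) (U i)) ->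
  is_series (fun n => sum_n (u n) m) (sum_n U m).
Proof.
  intros H. induction m as [|m IH].
  - rewrite sum_O. apply (is_series_ext (fun n => u n 0%nat)); [|easy].
    intros n. by rewrite sum_O.
  - rewrite sum_Sn.
    apply (is_series_ext (fun n => plus (sum_n (u n) m) (u n (S m)))).
    + intros n. by rewrite sum_Sn.
    + now apply is_series_plus.
Qed.

Lemma is_series_of_zeros (u : nat -> V) (l : V) :
  (forall n, u n = zero) -> is_series u l -> l = zero.
Proof.
  intros Hu Hl.
  apply (filterlim_locally_unique (F := eventually) (sum_n u)); [exact Hl|].
  apply (filterlim_ext (fun _ => zero)); [|apply filterlim_const].
  intros n. symmetry. apply sum_n_eq_zero. intros i _. apply Hu.
Qed.

End Series.

Lemma is_series_linear {K : AbsRing} {U V : NormedModule K} (l : U -> V)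
  (u : nat -> U) (s : U) :
  is_linear l -> is_series u s -> is_series (fun n => l (u n)) (l s).
Proof.
  intros Hl Hs.
  apply (filterlim_ext (fun n => l (sum_n u n))).
  - induction x as [|n IH]; [by rewrite !sum_O|].
    by rewrite !sum_Sn (linear_plus l Hl) IH.
  - apply (filterlim_comp _ _ _ (sum_n u) l _ _ _ Hs). now apply linear_cont.
Qed.

Section OperatorSeries.
Context {K : AbsRing} {B Bbar : NormedModule K}.
Hypothesis K_scalars : scalars_of_every_size K.

(** At one invertible eps near 0 consecutive partial sums of the operator
    series are uniformly close, which bounds the terms eps^i L_i for large i;
    then eps^i is cancelled. The other L_i are bounded individually. *)
Lemma operator_bounds (Lf : K -> B -> Bbar) (L : nat -> B -> Bbar) :
  analytic_family Lf L ->
  exists A rho, 0 <= A /\ 1 <= rho /\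
    forall i x, norm (L i x) <= A * rho ^ i * norm x.
Proof.
  intros [Hlin [d Hd]].
  destruct (K_scalars (d / 2)) as (s & s' & Hs & Hs' & Hss).
  { assert (H := cond_pos d). lra. }
  assert (Hball : ball (M := AbsRing_UniformSpace K) zero d s).
  { change (abs (minus s zero) < d). rewrite minus_zero_r.
    assert (H := cond_pos d). lra. }
  destruct (Hd s Hball (mkposreal 1 Rlt_0_1)) as [n0 Hn0]. simpl in Hn0.
  assert (Hlow : exists M, 0 <= M /\
    forall i x, (i <= n0)%nat -> norm (L i x) <= M * norm x).
  { assert (Hm : forall i, exists m, forall x, norm (L i x) <= m * norm x).
    { intros i. destruct (linear_norm _ (Hlin i)) as (m & _ & Hm). now exists m. }
    destruct (choice _ Hm) as [m Hm'].
    destruct (finite_bound m n0) as (M & HM & Hle). exists M. split; [easy|].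
    intros i x Hi. apply Rle_trans with (m i * norm x).
    - apply Hm'.
    - apply Rmult_le_compat_r; [apply norm_ge_0|now apply Hle]. }
  destruct Hlow as (M & HM & Hlow).
  set (rho := Rmax 1 (/ (d / 2))).
  assert (Hrho : 1 <= rho) by apply Rmax_l.
  exists (M + 2), rho. split; [lra|]. split; [easy|]. intros i x.
  assert (Hpow : 1 <= rho ^ i) by now apply pow_R1_Rle.
  assert (Hx := norm_ge_0 x).
  destruct (Nat.le_gt_cases i n0) as [Hi|Hi].
  - eapply Rle_trans; [now apply Hlow|]. apply Rmult_le_compat_r; [easy|]. nra.
  - destruct i as [|i]; [lia|].
    assert (H1 := Hn0 i ltac:(lia) x). assert (H2 := Hn0 (S i) ltac:(lia) x).
    set (S0 := sum_n (fun i => scal (pow_n s i) (L i x)) i) in H1.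
    set (S1 := sum_n (fun i => scal (pow_n s i) (L i x)) (S i)) in H2.
    assert (Eterm : scal (pow_n s (S i)) (L (S i) x) = minus S1 S0).
    { unfold S1. rewrite sum_Sn. symmetry.
      apply (minus_plus_l (G := Bbar) S0 (scal (pow_n s (S i)) (L (S i) x))). }
    assert (Hterm : norm (scal (pow_n s (S i)) (L (S i) x)) <= 2 * norm x).
    { rewrite Eterm. eapply Rle_trans; [apply (norm_minus_triangle (Lf s x))|].
      rewrite (norm_minus_comm (Lf s x)).
      eapply Rle_trans; [apply Rplus_le_compat; [exact H2|exact H1]|]. lra. }
    rewrite -(scal_one (L (S i) x)) -(pow_n_cancel s s' (S i) Hss) -scal_assoc.
    eapply Rle_trans; [apply norm_scal|].
    assert (Hs'0 := abs_ge_0 s').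
    assert (Hs'r : abs (pow_n s' (S i)) <= rho ^ S i).
    { eapply Rle_trans; [apply abs_pow_n|]. apply pow_incr. split; [easy|].
      apply Rle_trans with (/ (d / 2)); [easy|apply Rmax_r]. }
    apply Rle_trans with (rho ^ S i * (2 * norm x)).
    + apply Rmult_le_compat; [apply abs_ge_0|apply norm_ge_0|easy|easy].
    + assert (0 <= rho ^ S i * norm x) by (apply Rmult_le_pos; lra). nra.
Qed.

Variables (L : nat -> B -> Bbar) (A rho : R).
Hypothesis L_linear : forall i, is_linear (L i).
Hypothesis A_pos : 0 <= A.
Hypothesis rho_ge_1 : 1 <= rho.
Hypothesis L_bound : forall i x, norm (L i x) <= A * rho ^ i * norm x.

Lemma L_additive i x y : L i (plus x y) = plus (L i x) (L i y).
Proof. apply (linear_plus _ (L_linear i)). Qed.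

(** At most n + 1 terms of size A c rho^n occur, and n + 1 is at most 2^n. *)
Lemma coef_bound (b : nat -> B) (c : R) (n : nat) :
  (forall i, (i <= n)%nat -> norm (b i) <= c) ->
  norm (coef L b n) <= A * c * (2 * rho) ^ n.
Proof.
  intros Hb.
  assert (Hc : 0 <= c) by (apply Rle_trans with (norm (b 0%nat));
    [apply norm_ge_0|apply Hb; lia]).
  assert (Hr : forall i, 0 <= rho ^ i) by (intros i; apply pow_le; lra).
  assert (HAc : 0 <= A * c) by now apply Rmult_le_pos.
  eapply Rle_trans; [apply norm_sum_n_m|].
  rewrite (sum_n_m_ext_loc _ (fun i => if (i <=? n)%nat then norm (L i (b (n - i)%nat)) else 0)).
  2: { intros i Hi. now destruct (Nat.leb_spec i n); [|lia]. }
  eapply Rle_trans.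
  - apply (sum_n_m_le _ (fun _ => A * c * rho ^ n)). intros i.
    destruct (Nat.leb_spec i n) as [Hi|Hi]; [|now apply Rmult_le_pos].
    eapply Rle_trans; [apply L_bound|].
    assert (Hb' := Hb (n - i)%nat ltac:(lia)).
    assert (Hb0 := norm_ge_0 (b (n - i)%nat)).
    assert (Hmon : rho ^ i <= rho ^ n) by (apply Rle_pow; [easy|lia]).
    replace (A * c * rho ^ n) with (A * rho ^ n * c) by ring.
    apply Rmult_le_compat; [now apply Rmult_le_pos|easy| |easy].
    now apply Rmult_le_compat_l.
  - rewrite sum_n_m_const Nat.sub_0_r Rpow_mult_distr.
    assert (H := succ_le_pow2 n).
    assert (HAr : 0 <= A * c * rho ^ n) by now apply Rmult_le_pos.
    replace (A * c * (2 ^ n * rho ^ n)) with (2 ^ n * (A * c * rho ^ n)) by ring.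
    now apply Rmult_le_compat_r.
Qed.

Lemma is_series_coef (b : nat -> nat -> B) (b' : nat -> B) (m : nat) :
  (forall i, is_series (fun n => b n i) (b' i)) ->
  is_series (fun n => coef L (b n) m) (coef L b' m).
Proof.
  intros H. apply (is_series_sum_n (fun n i => L i (b n (m - i)%nat))
    (fun i => L i (b' (m - i)%nat))).
  intros i. now apply (is_series_linear (L i) (fun n => b n (m - i)%nat)).
Qed.

Lemma coef_scal (a : K) (b : nat -> B) (n : nat) :
  coef L (fun i => scal a (b i)) n = scal a (coef L b n).
Proof.
  unfold coef. rewrite -sum_n_scal_l. apply sum_n_ext. intros i.
  apply (linear_scal _ (L_linear i)).
Qed.

End OperatorSeries.

(** * Correction of a truncated formal solution *)

Section Approximation.
Context {K : AbsRing} {B Bbar : NormedModule K}.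
Hypothesis K_scalars : scalars_of_every_size K.
Hypothesis B_complete : geometrically_complete B.
Hypothesis Bbar_complete : geometrically_complete Bbar.
Variables (L : nat -> B -> Bbar) (A rho : R).
Hypothesis L_linear : forall i, is_linear (L i).
Hypothesis A_pos : 0 <= A.
Hypothesis rho_ge_1 : 1 <= rho.
Hypothesis L_bound : forall i x, norm (L i x) <= A * rho ^ i * norm x.
Variables (k : nat) (Rc : Bbar -> Prop).
Hypothesis Rc_subspace : is_subspace Rc.
Hypothesis Rc_closed : closed Rc.
Hypothesis total : forall y : Bbar, exists (b : nat -> B) (w : Bbar),
  vanishes_below L k b /\ Rc w /\ y = plus (coef L b k) w.

Let L_plus := L_additive L L_linear.

Lemma Rc_opp (w : Bbar) : Rc w -> Rc (opp w).
Proof. intros Hw. rewrite -scal_opp_one. now apply Rc_subspace. Qed.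

(** The open mapping theorem for the map (b, w) |-> (coefficient of eps^k in
    L b) + w, on the bounded series that vanish below k and on the closed
    subspace Rc. It is onto by [total], and its domain is complete since
    coefficients of L b are continuous in b. *)
Lemma bounded_correction : exists C, 0 <= C /\ forall y : Bbar, exists b : nat -> B,
  (forall i, norm (b i) <= C * norm y) /\ vanishes_below L k b /\
  Rc (minus y (coef L b k)).
Proof.
  destruct Rc_subspace as (Rc_zero & Rc_plus & Rc_scal).
  set (P := fun (c : R) (y : Bbar) => exists (b : nat -> B) (w : Bbar),
    (forall i, norm (b i) <= c) /\ norm w <= c /\
    vanishes_below L k b /\ Rc w /\ y = plus (coef L b k) w).
  assert (Hmap : exists C, 0 <= C /\ forall y : Bbar, P (C * norm y) y).
  { apply (open_mapping Bbar_complete K_scalars P).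
    - intros c c' y Hc (b & w & Hb & Hw & Hbw). exists b, w.
      split; [|split; [|easy]].
      + intros i. now apply Rle_trans with c.
      + now apply Rle_trans with c.
    - intros c c' y y' (b & w & Hb & Hw & Hv & Hc & ->)
        (b' & w' & Hb' & Hw' & Hv' & Hc' & ->).
      exists (fun i => minus (b i) (b' i)), (minus w w').
      split; [|split; [|split; [|split]]].
      + intros i. eapply Rle_trans; [apply norm_minus_le|].
        now apply Rplus_le_compat.
      + eapply Rle_trans; [apply norm_minus_le|]. now apply Rplus_le_compat.
      + now apply (vanishes_minus L L_plus).
      + apply Rc_plus; [easy|now apply Rc_opp].
      + rewrite (coef_minus L L_plus).
        apply (minus_plus_plus (G := Bbar)).
    - intros a c y (b & w & Hb & Hw & Hv & Hc & ->).
      exists (fun i => scal a (b i)), (scal a w).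
      split; [|split; [|split; [|split]]].
      + intros i. eapply Rle_trans; [apply norm_scal|].
        apply Rmult_le_compat_l; [apply abs_ge_0|easy].
      + eapply Rle_trans; [apply norm_scal|].
        apply Rmult_le_compat_l; [apply abs_ge_0|easy].
      + intros i Hi. rewrite coef_scal; [|easy]. rewrite (Hv i Hi).
        apply scal_zero_r.
      + now apply Rc_scal.
      + rewrite coef_scal; [|easy]. apply scal_distr_l.
    - intros c u y Hu Hy.
      destruct (choice _ Hu) as [b Hb]. destruct (choice _ Hb) as [w Hw]. clear Hb.
      assert (Hb' : forall i, exists s, is_series (fun n => b n i) s /\ norm s <= 2 * c).
      { intros i. destruct (geometric_series (fun n => b n i) c (1 / 2)) as (s & Hs & Hn & _).
        - exact B_complete.
        - lra.
        - intros n. apply Hw.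
        - now exists s. }
      destruct (choice _ Hb') as [b' Hb'']. clear Hb'.
      destruct (geometric_series w c (1 / 2)) as (w' & Hw' & Hn' & _).
      { exact Bbar_complete. }
      { lra. }
      { intros n. apply Hw. }
      assert (Hcoef : forall m, is_series (fun n => coef L (b n) m) (coef L b' m)).
      { intros m. apply is_series_coef; [easy|]. intros i. apply Hb''. }
      exists b', w'. split; [|split; [|split; [|split]]].
      + intros i. apply Hb''.
      + exact Hn'.
      + intros m Hm. apply (is_series_of_zeros (fun n => coef L (b n) m));
          [|apply Hcoef].
        intros n. now apply Hw.
      + apply (closed_filterlim (F := eventually) (sum_n w) Rc w' Hw'); [|easy].
        induction x as [|n IH].
        * rewrite sum_O. apply Hw.
        * rewrite sum_Sn. apply Rc_plus; [easy|apply Hw].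
      + apply (filterlim_locally_unique (F := eventually) (sum_n u)); [exact Hy|].
        apply (is_series_ext (fun n => plus (coef L (b n) k) (w n))).
        * intros n. symmetry. apply Hw.
        * now apply is_series_plus.
    - intros y. destruct (total y) as (b & w & Hv & Hw & ->).
      destruct (finite_bound (fun i => norm (b i)) k) as (M & HM & Hb).
      exists (M + norm w), (fun i => if (i <=? k)%nat then b i else zero), w.
      assert (Hw0 := norm_ge_0 w).
      assert (E : forall m, (m <= k)%nat ->
        coef L (fun i => if (i <=? k)%nat then b i else zero) m = coef L b m).
      { intros m Hm. apply coef_ext. intros i Hi.
        now destruct (Nat.leb_spec i k); [|lia]. }
      split; [|split; [lra|split; [|split; [easy|now rewrite E]]]].
      + intros i. destruct (Nat.leb_spec i k) as [Hi|Hi].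
        * specialize (Hb i Hi). simpl in Hb. lra.
        * rewrite (@norm_zero K B). lra.
      + intros m Hm. rewrite E; [now apply Hv|lia]. }
  destruct Hmap as (C & HC & Hmap). exists C. split; [easy|]. intros y.
  destruct (Hmap y) as (b & w & Hb & _ & Hv & Hw & E).
  exists b. split; [easy|]. split; [easy|].
  rewrite {1}E. rewrite (minus_plus_l (G := Bbar) (coef L b k) w). exact Hw.
Qed.

Variables (p : nat -> B) (M : R) (q : nat).
Hypothesis M_pos : 0 <= M.
Hypothesis p_bound : forall i, norm (p i) <= M.
Hypothesis p_vanishes : vanishes_below L (q + k) p.

(** Each correction changes the later coefficients of L a by at most a fixed
    multiple of its own size, up to powers of rho, so the sizes of the
    corrections grow at most geometrically. *)
Lemma geometric_correction : (0 < q)%nat ->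
  exists (a : nat -> B) (E theta : R), 0 <= E /\ 0 <= theta /\
    (forall i, norm (a i) <= E * theta ^ i) /\
    (forall i, (i < q)%nat -> a i = p i) /\
    vanishes_below L (q + k) a /\
    forall n, Rc (coef L a (q + k + n)).
Proof.
  intros Hq. destruct bounded_correction as (C & HC & Hcorr).
  destruct (choice _ Hcorr) as [phi Hphi]. clear Hcorr.
  (* Stage n + 1 treats the coefficient of order q + k + n, using a correction
     multiplied by eps^(q + n). *)
  set (approx := fix approx n : nat -> B := match n with
    | O => p
    | S n => fun i => plus (approx n i)
       (shift (q + n) (phi (opp (coef L (approx n) (q + k + n)))) i) end).
  set (z := fun n => opp (coef L (approx n) (q + k + n))).
  assert (Hstep : forall n m, coef L (approx (S n)) m =
    plus (coef L (approx n) m) (coef L (shift (q + n) (phi (z n))) m)).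
  { intros n m. apply (coef_plus L L_plus). }
  assert (Hstable : forall n d i, (i < q + n)%nat -> approx (n + d)%nat i = approx n i).
  { intros n d i Hi. induction d as [|d IH]; [by rewrite Nat.add_0_r|].
    rewrite Nat.add_succ_r -IH. change (approx (S (n + d)) i) with
      (plus (approx (n + d)%nat i) (shift (q + (n + d)) (phi (z (n + d)%nat)) i)).
    unfold shift. destruct (Nat.ltb_spec i (q + (n + d))); [apply plus_zero_r|lia]. }
  assert (Hcstable : forall n d m, (m < q + k + n)%nat ->
    coef L (approx (n + d)%nat) m = coef L (approx n) m).
  { intros n d m Hm. induction d as [|d IH]; [by rewrite Nat.add_0_r|].
    rewrite Nat.add_succ_r Hstep IH.
    destruct (Nat.lt_ge_cases m (q + (n + d))).
    - rewrite (coef_shift_lt L L_plus); [apply plus_zero_r|easy].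
    - rewrite (coef_shift_ge L L_plus); [|easy].
      rewrite (proj1 (proj2 (Hphi (z (n + d)%nat)))); [apply plus_zero_r|lia]. }
  (* The coefficient i is final from stage i on, since q is positive. *)
  set (a := fun i => approx i i).
  assert (Ha : forall n i, (i < q + n)%nat -> a i = approx n i).
  { intros n i Hi. unfold a. rewrite -(Hstable n i i Hi).
    rewrite (Nat.add_comm n i). symmetry. apply Hstable. lia. }
  assert (Hca : forall n m, (m < q + k + n)%nat -> coef L a m = coef L (approx n) m).
  { intros n m Hm. rewrite -(Hcstable n m m Hm). apply coef_ext.
    intros i Hi. apply Ha. lia. }
  set (D := A * C * (2 * rho) ^ k).
  set (sigma := 2 * rho).
  assert (Hsigma : forall n, 0 <= sigma ^ n) by (intros n; apply pow_le; unfold sigma; lra).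
  assert (HD : 0 <= D) by (repeat apply Rmult_le_pos; try easy; apply Hsigma).
  set (C' := A * M * sigma ^ (q + k)).
  assert (HC' : 0 <= C') by (repeat apply Rmult_le_pos; try easy; apply Hsigma).
  assert (HD1 : forall n, 0 <= (1 + D) ^ n) by (intros n; apply pow_le; lra).
  assert (Hres : forall n j, norm (coef L (approx n) (q + k + n + j)) <=
    C' * (1 + D) ^ n * sigma ^ (n + j)).
  { induction n as [|n IH]; intros j.
    - eapply Rle_trans; [apply (coef_bound L A rho A_pos rho_ge_1 L_bound p M)|].
      + intros i _. apply p_bound.
      + fold sigma. rewrite Nat.add_0_r Nat.add_0_l pow_add.
        unfold C'. simpl. right. ring.
    - rewrite Hstep. eapply Rle_trans; [apply norm_triangle|].
      assert (Hz : norm (z n) <= C' * (1 + D) ^ n * sigma ^ n).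
      { unfold z. rewrite norm_opp. specialize (IH 0%nat). by rewrite !Nat.add_0_r in IH. }
      rewrite (coef_shift_ge L L_plus); [|lia].
      replace (q + k + S n + j - (q + n))%nat with (k + S j)%nat by lia.
      assert (H1 : norm (coef L (phi (z n)) (k + S j)) <=
        D * sigma ^ S j * norm (z n)).
      { eapply Rle_trans; [apply (coef_bound L A rho A_pos rho_ge_1 L_bound _ (C * norm (z n)))|].
        - intros i _. apply Hphi.
        - fold sigma. rewrite pow_add. unfold D. fold sigma. right. ring. }
      assert (H2 := IH (S j)).
      replace (q + k + n + S j)%nat with (q + k + S n + j)%nat in H2 by lia.
      eapply Rle_trans; [apply Rplus_le_compat; [exact H2|exact H1]|].
      apply (Rmult_le_compat_l (D * sigma ^ S j)) in Hz; [|now apply Rmult_le_pos].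
      replace (S n + j)%nat with (n + S j)%nat by lia. rewrite pow_add.
      rewrite -(tech_pow_Rmult (1 + D) n).
      eapply Rle_trans; [apply Rplus_le_compat_l; exact Hz|]. right. ring. }
  set (tau := (1 + D) * sigma).
  assert (Hz : forall n, norm (z n) <= C' * tau ^ n).
  { intros n. unfold z, tau. rewrite norm_opp Rpow_mult_distr -Rmult_assoc.
    specialize (Hres n 0%nat). by rewrite !Nat.add_0_r in Hres. }
  assert (Htau : 0 <= tau) by (apply Rmult_le_pos; [lra|unfold sigma; lra]).
  assert (HCC : 0 <= C * C') by now apply Rmult_le_pos.
  assert (Happrox : forall n i, norm (approx n i) <= (M + C * C') * (1 + tau) ^ n).
  { induction n as [|n IH]; intros i.
    - simpl. specialize (p_bound i). lra.
    - simpl. eapply Rle_trans; [apply norm_triangle|].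
      assert (Hp1 : 0 <= tau ^ n <= (1 + tau) ^ n)
        by (split; [now apply pow_le|apply pow_incr; lra]).
      assert (Hsh : norm (shift (q + n) (phi (z n)) i) <= C * C' * tau ^ n).
      { unfold shift. destruct (i <? q + n)%nat.
        - rewrite (@norm_zero K B). apply Rmult_le_pos; lra.
        - eapply Rle_trans; [apply Hphi|]. rewrite Rmult_assoc.
          now apply Rmult_le_compat_l. }
      eapply Rle_trans; [apply Rplus_le_compat; [apply IH|exact Hsh]|].
      assert (Htau1 : 1 <= tau) by (unfold tau, sigma; nra).
      assert (Hx : tau ^ n <= tau * (1 + tau) ^ n) by nra.
      assert (HMC : C * C' <= M + C * C') by lra.
      apply Rle_trans with ((M + C * C') * (1 + tau) ^ n
        + (M + C * C') * (tau * (1 + tau) ^ n)); [|right; ring].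
      apply Rplus_le_compat_l. apply Rmult_le_compat; lra. }
  exists a, (M + C * C'), (1 + tau).
  split; [lra|]. split; [lra|]. split; [|split; [|split]].
  - intros i. apply Happrox.
  - intros i Hi. apply (Ha 0%nat). lia.
  - intros m Hm. rewrite (Hca 0%nat); [now apply p_vanishes|lia].
  - intros n. rewrite (Hca (S n)); [|lia]. rewrite Hstep (coef_shift_ge L L_plus); [|lia].
    replace (q + k + n - (q + n))%nat with k by lia.
    destruct (Hphi (z n)) as (_ & _ & Hc). apply Rc_opp in Hc.
    rewrite (@opp_minus Bbar) in Hc. unfold minus in Hc. unfold z at 2 in Hc.
    rewrite (@opp_opp Bbar) in Hc. rewrite plus_comm. exact Hc.
Qed.

End Approximation.

(** * Evaluation of formal solutions *)

Section Evaluation.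
Context {K : AbsRing} {B Bbar : NormedModule K}.
Hypothesis B_complete : geometrically_complete B.
Variables (L : nat -> B -> Bbar) (A rho : R).
Hypothesis L_linear : forall i, is_linear (L i).
Hypothesis A_pos : 0 <= A.
Hypothesis rho_ge_1 : 1 <= rho.
Hypothesis L_bound : forall i x, norm (L i x) <= A * rho ^ i * norm x.
Variables (a : nat -> B) (E theta : R).
Hypothesis E_pos : 0 <= E.
Hypothesis theta_pos : 0 <= theta.
Hypothesis a_bound : forall i, norm (a i) <= E * theta ^ i.

Lemma abs_pow_scaled (eps : K) (r : R) (n : nat) :
  0 <= r -> abs eps * r <= 1 / 4 -> abs (pow_n eps n) * r ^ n <= (1 / 4) ^ n.
Proof.
  intros Hr Hq. apply Rle_trans with ((abs eps * r) ^ n).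
  - rewrite Rpow_mult_distr. apply Rmult_le_compat_r; [now apply pow_le|].
    apply abs_pow_n.
  - apply pow_incr. split; [|easy]. apply Rmult_le_pos; [apply abs_ge_0|easy].
Qed.

Lemma pseries_limit (eps : K) : abs eps * theta <= 1 / 4 ->
  exists l, is_pseries a eps l /\
    forall n, norm (minus l (sum_n (fun i => scal (pow_n eps i) (a i)) n))
      <= 2 * E * (1 / 4) ^ n.
Proof.
  intros Hq.
  destruct (geometric_series (fun i => scal (pow_n eps i) (a i)) E (1 / 4))
    as (l & Hl & _ & Ht); [exact B_complete|lra| |now exists l].
  intros n. eapply Rle_trans; [apply norm_scal|].
  apply Rle_trans with (abs (pow_n eps n) * (E * theta ^ n)).
  - apply Rmult_le_compat_l; [apply abs_ge_0|apply a_bound].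
  - replace (abs (pow_n eps n) * (E * theta ^ n)) with
      (E * (abs (pow_n eps n) * theta ^ n)) by ring.
    apply Rmult_le_compat_l; [easy|]. now apply abs_pow_scaled.
Qed.

(** Summing the Cauchy product by the operator index: the operator L_i meets
    the partial sum of order n - i. *)
Lemma sum_coef (eps : K) (n : nat) :
  sum_n (fun i => scal (pow_n eps i)
    (L i (sum_n (fun j => scal (pow_n eps j) (a j)) (n - i)))) n =
  sum_n (fun m => scal (pow_n eps m) (coef L a m)) n.
Proof.
  induction n as [|n IH].
  - rewrite !sum_O. unfold coef. rewrite !sum_O. simpl.
    by rewrite (linear_scal _ (L_linear 0%nat)) !scal_one.
  - rewrite (sum_Sn (fun m => scal (pow_n eps m) (coef L a m))) -IH.
    rewrite sum_Sn Nat.sub_diag sum_O.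
    rewrite (sum_n_ext_loc _ (fun i => plus
      (scal (pow_n eps i) (L i (sum_n (fun j => scal (pow_n eps j) (a j)) (n - i))))
      (scal (pow_n eps (S n)) (L i (a (S n - i)%nat))))).
    + rewrite sum_n_plus -plus_assoc. f_equal.
      rewrite sum_n_scal_l (linear_scal _ (L_linear (S n))).
      change (pow_n eps 0) with (@one K). rewrite scal_one -scal_distr_l.
      f_equal. unfold coef. by rewrite sum_Sn Nat.sub_diag.
    + intros i Hi. replace (S n - i)%nat with (S (n - i)) by lia.
      rewrite sum_Sn (linear_plus _ (L_linear i)) scal_distr_l. f_equal.
      rewrite (linear_scal _ (L_linear i)) scal_assoc -pow_n_plus.
      do 2 f_equal. lia.
Qed.

(** As L a = 0, the partial sum of the operator series may be applied to the
    remainders of the series a instead of to its sum l. Each of the n + 1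
    summands is then of order (1/4)^n. *)
Lemma operator_sum_small (eps : K) (l : B) (n : nat) :
  (forall m, coef L a m = zero) -> abs eps * rho <= 1 / 4 ->
  (forall n, norm (minus l (sum_n (fun i => scal (pow_n eps i) (a i)) n))
    <= 2 * E * (1 / 4) ^ n) ->
  norm (sum_n (fun i => scal (pow_n eps i) (L i l)) n) <= 2 * A * E * (1 / 2) ^ n.
Proof.
  intros Hcoef Heps Hl.
  set (part := sum_n (fun j => scal (pow_n eps j) (a j))).
  assert (Esum : sum_n (fun i => scal (pow_n eps i) (L i l)) n =
    sum_n (fun i => scal (pow_n eps i) (L i (minus l (part (n - i)%nat)))) n).
  { rewrite -(plus_zero_r (sum_n (fun i => scal (pow_n eps i)
      (L i (minus l (part (n - i)%nat)))) n)).
    rewrite -(sum_n_eq_zero (fun m => scal (pow_n eps m) (coef L a m)) n).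
    - rewrite -sum_coef -sum_n_plus. apply sum_n_ext. intros i.
      rewrite -scal_distr_l -(linear_plus _ (L_linear i)). do 2 f_equal.
      fold part. unfold minus. rewrite -plus_assoc (@plus_opp_l B).
      by rewrite plus_zero_r.
    - intros m _. rewrite Hcoef. apply scal_zero_r. }
  rewrite Esum. eapply Rle_trans; [apply norm_sum_n_m|].
  rewrite (sum_n_m_ext_loc _ (fun i => if (i <=? n)%nat then
    norm (scal (pow_n eps i) (L i (minus l (part (n - i)%nat)))) else 0)).
  2: { intros i Hi. now destruct (Nat.leb_spec i n); [|lia]. }
  assert (Hpos : forall m, 0 <= (1 / 4) ^ m) by (intros m; apply pow_le; lra).
  assert (HAE : 0 <= A * E) by now apply Rmult_le_pos.
  eapply Rle_trans.
  - apply (sum_n_m_le _ (fun _ => 2 * A * E * (1 / 4) ^ n)). intros i.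
    specialize (Hpos n).
    destruct (Nat.leb_spec i n) as [Hi|Hi]; [|nra].
    eapply Rle_trans; [apply norm_scal|].
    apply Rle_trans with (abs (pow_n eps i) *
      (A * rho ^ i * (2 * E * (1 / 4) ^ (n - i)))).
    + apply Rmult_le_compat_l; [apply abs_ge_0|].
      eapply Rle_trans; [apply L_bound|]. apply Rmult_le_compat_l; [|apply Hl].
      apply Rmult_le_pos; [easy|apply pow_le; lra].
    + replace n with (i + (n - i))%nat at 2 by lia. rewrite pow_add.
      assert (H := abs_pow_scaled eps rho i ltac:(lra) Heps).
      replace (abs (pow_n eps i) * (A * rho ^ i * (2 * E * (1 / 4) ^ (n - i))))
        with (abs (pow_n eps i) * rho ^ i * (2 * A * E * (1 / 4) ^ (n - i))) by ring.
      replace (2 * A * E * ((1 / 4) ^ i * (1 / 4) ^ (n - i))) with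
        ((1 / 4) ^ i * (2 * A * E * (1 / 4) ^ (n - i))) by ring.
      apply Rmult_le_compat_r; [|easy].
      assert (H4 : 0 <= (1 / 4) ^ (n - i)) by (apply pow_le; lra). nra.
  - rewrite sum_n_m_const Nat.sub_0_r.
    replace ((1 / 2) ^ n) with (2 ^ n * (1 / 4) ^ n)
      by (rewrite -Rpow_mult_distr; f_equal; lra).
    assert (H := succ_le_pow2 n). specialize (Hpos n).
    replace (2 * A * E * (2 ^ n * (1 / 4) ^ n)) with
      (2 ^ n * (2 * A * E * (1 / 4) ^ n)) by ring.
    apply Rmult_le_compat_r; [nra|easy].
Qed.

Lemma analytic_solution (Lf : K -> B -> Bbar) :
  analytic_family Lf L -> (forall m, coef L a m = zero) ->
  exists bs : K -> B, has_pseries_at_0 bs a /\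
    locally (T := AbsRing_UniformSpace K) zero (fun eps => Lf eps (bs eps) = zero).
Proof.
  intros [_ [d Hd]] Hcoef.
  set (t := Rmin d (Rmin (/ (4 * (theta + 1))) (/ (4 * rho)))).
  assert (Ht : 0 < t).
  { unfold t. assert (H := cond_pos d).
    repeat apply Rmin_pos; [easy|apply Rinv_0_lt_compat; lra..]. }
  assert (Hsmall : forall r eps : R, 0 <= eps -> 0 < r -> eps < / (4 * r) ->
    eps * r <= 1 / 4).
  { intros r eps Heps Hr H. apply Rmult_lt_compat_r with (r := r) in H; [|easy].
    replace (/ (4 * r) * r) with (1 / 4) in H by (field; lra). lra. }
  assert (Hball : forall eps : K,
    ball (M := AbsRing_UniformSpace K) zero (mkposreal t Ht) eps ->
    is_op_pseries L eps (Lf eps) /\ abs eps * theta <= 1 / 4 /\ abs eps * rho <= 1 / 4).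
  { intros eps Heps. change (abs (minus eps zero) < t) in Heps.
    rewrite minus_zero_r in Heps. assert (H0 := abs_ge_0 eps).
    assert (H1 := Rmin_l d (Rmin (/ (4 * (theta + 1))) (/ (4 * rho)))).
    assert (H2 := Rmin_r d (Rmin (/ (4 * (theta + 1))) (/ (4 * rho)))).
    assert (H3 := Rmin_l (/ (4 * (theta + 1))) (/ (4 * rho))).
    assert (H4 := Rmin_r (/ (4 * (theta + 1))) (/ (4 * rho))).
    fold t in H1, H2. split; [|split].
    - apply Hd. change (abs (minus eps zero) < d). rewrite minus_zero_r. lra.
    - assert (H5 := Hsmall (theta + 1) (abs eps) H0 ltac:(lra) ltac:(lra)). nra.
    - apply Hsmall; lra. }
  set (bs := fun eps => epsilon (inhabits zero) (is_pseries a eps)).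
  assert (Hbs : forall eps, abs eps * theta <= 1 / 4 -> is_pseries a eps (bs eps)).
  { intros eps Heps. apply epsilon_spec.
    destruct (pseries_limit eps Heps) as (l & Hl & _). now exists l. }
  exists bs. split.
  - exists (mkposreal t Ht). intros eps Heps. now apply Hbs, Hball.
  - exists (mkposreal t Ht). intros eps Heps.
    destruct (Hball eps Heps) as (Hop & Hth & Hrho).
    destruct (pseries_limit eps Hth) as (l & Hl & Hlb).
    assert (El : bs eps = l).
    { apply (filterlim_locally_unique (F := eventually)
        (sum_n (fun i => scal (pow_n eps i) (a i)))); [now apply Hbs|exact Hl]. }
    rewrite El. apply norm_eq_zero. apply Rle_antisym; [|apply norm_ge_0].
    apply le_epsilon. intros e He. rewrite Rplus_0_l.
    assert (Hl0 := norm_ge_0 l).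
    assert (He1 : 0 < e / (2 * (norm l + 1))) by (apply Rdiv_lt_0_compat; lra).
    destruct (Hop (mkposreal _ He1)) as [n0 Hn0]. simpl in Hn0.
    assert (HAE : 0 <= A * E) by now apply Rmult_le_pos.
    assert (He2 : 0 < e / (2 * (2 * A * E + 1))) by (apply Rdiv_lt_0_compat; lra).
    destruct (pow_lt_1_zero (1 / 2)) with (y := e / (2 * (2 * A * E + 1))) as [n1 Hn1].
    { rewrite Rabs_pos_eq; lra. }
    { easy. }
    set (n := (n0 + n1)%nat).
    assert (H1 := Hn0 n ltac:(lia) l). assert (H2 := Hn1 n ltac:(lia)).
    assert (H3 := operator_sum_small eps l n Hcoef Hrho Hlb).
    assert (Hp : 0 <= (1 / 2) ^ n) by (apply pow_le; lra).
    rewrite Rabs_pos_eq in H2; [|easy].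
    set (Tn := sum_n (fun i => scal (pow_n eps i) (L i l)) n) in H1, H3.
    assert (H4 := norm_le_minus (Lf eps l) Tn).
    rewrite norm_minus_comm in H4.
    assert (H5 : e / (2 * (norm l + 1)) * norm l <= e / 2).
    { apply Rle_trans with (e / (2 * (norm l + 1)) * (norm l + 1)).
      - apply Rmult_le_compat_l; lra.
      - right. field. lra. }
    assert (H6 : 2 * A * E * (1 / 2) ^ n <= e / 2).
    { apply Rle_trans with ((2 * A * E + 1) * (e / (2 * (2 * A * E + 1)))).
      - apply Rmult_le_compat; lra.
      - right. field. lra. }
    eapply Rle_trans; [exact H4|].
    apply Rle_trans with (e / 2 + e / 2); [apply Rplus_le_compat|lra].
    + eapply Rle_trans; [exact H1|exact H5].
    + eapply Rle_trans; [exact H3|exact H6].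
Qed.

End Evaluation.

Theorem mainTheorem5
  (K : AbsRing) (HK : K = R_AbsRing \/ K = C_AbsRing)
  (B Bbar : CompleteNormedModule K)
  (Lf : K -> B -> Bbar) (L : nat -> B -> Bbar)
  (HL : analytic_family Lf L)
  (D : recursion L) (k : nat)
  (Hstab : stabilizes_at (rec_S D) k)
  (HNc : forall i, (1 <= i <= k + 1)%nat -> closed (rec_Nc D i))
  (HN : closed (rec_N D (k + 1)))
  (HR : forall i, (1 <= i <= k + 1)%nat -> closed (rec_R D i))
  (HRc : closed (rec_Rc D (k + 1)))
  (b : nat -> B) (Hb : formal_solution L b) :
  forall c : nat, exists (bs : K -> B) (a : nat -> B),
    has_pseries_at_0 bs a /\
    locally (T := AbsRing_UniformSpace K) zero
      (fun eps => Lf eps (bs eps) = zero) /\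
    forall n, (n <= c)%nat -> a n = b n.
Proof.
  intros c.
  assert (HS := scalars_R_or_C K HK).
  destruct (operator_bounds HS Lf L HL) as (A & rho & HA & Hrho & Hbound).
  assert (Hlin := proj1 HL).
  assert (Hplus : forall i (x y : B), L i (plus x y) = plus (L i x) (L i y))
    by (intros i; apply (linear_plus _ (Hlin i))).
  assert (Hst := stage_all L Hplus D (k + 1)).
  (* Truncation after the order c + k keeps the product zero up to that order,
     k orders beyond the last coefficient that must be preserved. *)
  set (p := fun i => if (i <=? c + k)%nat then b i else zero).
  assert (Hpb : forall i, (i <= c + k)%nat -> p i = b i).
  { intros i Hi. unfold p. now destruct (Nat.leb_spec i (c + k)); [|lia]. }
  destruct (finite_bound (fun i => norm (b i)) (c + k)) as (M & HM & Hp).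
  destruct (geometric_correction HS (geometric_limit B) (geometric_limit Bbar)
    L A rho Hlin HA Hrho Hbound k (rec_Rc D (k + 1))) with
    (p := p) (M := M) (q := S c)
    as (a & E & theta & HE & Hth & Hab & Hap & Hlow & Hhigh).
  - replace (k + 1)%nat with (S k) by lia. apply (rec_Rc_complement D k).
  - exact HRc.
  - intros y. destruct (stage_total _ _ _ Hst y) as (v & w & Hv & Hw & Ey).
    rewrite Nat.add_1_r in Hv. apply (correctable_succ L Hplus) in Hv.
    destruct Hv as (b' & Hb' & Ev). exists b', w. split; [easy|].
    split; [easy|]. now rewrite Ev.
  - exact HM.
  - intros i. unfold p. destruct (Nat.leb_spec i (c + k)); [now apply Hp|].
    now rewrite (@norm_zero K B).
  - intros m Hm. transitivity (coef L b m); [|exact (Hb m)].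
    apply coef_ext. intros i Hi. apply Hpb. lia.
  - lia.
  - assert (Hcoef : forall m, coef L a m = zero).
    { intros m. induction m as [m IH] using lt_wf_ind.
      destruct (Nat.lt_ge_cases m (S c + k)) as [Hm|Hm]; [now apply Hlow|].
      apply (stage_disjoint _ _ _ Hst).
      - apply (correctable_stable L Hplus D k Hstab (S m)).
        apply (correctable_succ L Hplus). now exists a.
      - replace m with (S c + k + (m - (S c + k)))%nat by lia. apply Hhigh. }
    destruct (analytic_solution (geometric_limit B) L A rho Hlin HA Hrho Hbound
      a E theta HE Hth Hab Lf HL Hcoef) as (bs & Hbs & Hker).
    exists bs, a. split; [exact Hbs|]. split; [exact Hker|].
    intros n Hn. rewrite Hap; [|lia]. apply Hpb. lia.
Qed.
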